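(* Let $\overline{M}$ be a connected smooth manifold with boundary, of dimension $n\ge 2$, endowed with a smooth projective structure. Suppose that there exist a boundary point $p\in\partial M$ and a local boundary chart $(r,y^1,\dots,y^{n-1})$ near $p$ such that the local Thomas invariant form satisfies $\Pi^0_\nu(p)\notin \mathrm{span}(\mathrm{d}r(p))$ for at least one $\nu$ with $1\le\nu\le n-1$. Then the boundary $\partial M$ is rigid, i.e. the only projective transformation of $\overline{M}$ that restricts to the identity map on $\partial M$ is the identity map of $\overline{M}$.
   Context: $\overline{M}$ has interior $M$ and boundary $\partial M$; the tangent space at a boundary point is a full $n$-dimensional vector space. Two torsion-free affine connections $\nabla,\hat\nabla$ on $\overline{M}$ are projectively equivalent if there is a $1$-form $\Upsilon$ with $\hat\nabla_XY=\nabla_XY+\Upsilon(X)Y+\Upsilon(Y)X$ for all vector fields $X,Y$. A projective structure on $\overline{M}$ is a class $[\nabla]$ of projectively equivalent torsion-free affine connections. A projective transformation is a diffeomorphism $\phi:\overline{M}\to\overline{M}$ such that $\phi^*\nabla$ is projectively equivalent to $\nabla$ for every $\nabla$ in the class. A boundary chart is a chart $(U,(r,y^1,\dots,y^{n-1}))$ in which $r$ is a boundary defining function: $\partial M\cap U=\{r=0\}$ and $\mathrm{d}r$ is nowhere zero on $\partial M\cap U$. Put $x^0=r$, $x^\mu=y^\mu$. Latin indices range over $0,\dots,n-1$, Greek indices over $1,\dots,n-1$; repeated indices are summed. In a chart $(x^i)$, if $\nabla$ is a connection in the class with Christoffel symbols $\Gamma^i_{jk}$, the (local) Thomas invariant is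 $\Pi^i_{jk}=\Gamma^i_{jk}-\frac{1}{n+1}\Gamma^l_{lk}\delta^i_j-\frac{1}{n+1}\Gamma^l_{lj}\delta^i_k$; it does not depend on the choice of $\nabla$ in the class. One writes $\Pi^i_j=\Pi^i_{jk}\,\mathrm{d}x^k$ (a $1$-form for each $i,j$). *)

(* Defs.v *)
From HB Require Import structures.
From mathcomp Require Import all_boot all_order all_algebra.
From mathcomp Require Import all_classical all_reals all_analysis.

Set Implicit Arguments.
Unset Strict Implicit.
Unset Printing Implicit Defensive.

Import Order.TTheory GRing.Theory Num.Theory.
Import numFieldNormedType.Exports.
Local Open Scope classical_set_scope.
Local Open Scope ring_scope.

Section HalfSpace.
Context {R : realType} {n : nat}.
Local Notation E := 'rV[R]_n.+1.

Definition halfspace : set E := [set x | 0 <= x 0 0].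

Definition evec (i : 'I_n.+1) : E := delta_mx 0 i.

Fixpoint Ck (k : nat) (W : set E) (f : E -> R) : Prop :=
  (forall x, W x -> continuous_at x f) /\
  if k is k'.+1 then
    forall i, (forall x, W x -> derivable f x (evec i)) /\
              Ck k' W (fun x => 'D_(evec i) f x)
  else True.

Definition smooth_open (W : set E) (f : E -> R) : Prop := forall k, Ck k W f.

Definition smooth_on (S : set E) (f : E -> R) : Prop :=
  forall x, S x -> exists W : set E, exists g : E -> R,
    [/\ open W, W x, smooth_open W g & forall y, W y -> S y -> f y = g y].

(* Partial derivative of a function on the half-space: only increments staying
   in the half-space are used, so the derivative in the direction of x^0 is
   one-sided at boundary points.  If f has a smooth extension near x, this is
   the partial derivative of any such extension. *)
Definition hpartial (i : 'I_n.+1) (f : E -> R) (x : E) : R :=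
  lim ((fun h : R => h^-1 * (f (h *: evec i + x) - f x))
        @ within [set h : R | halfspace (h *: evec i + x)] (0 : R)^').

End HalfSpace.

(* [param] is the inverse of [coord]; only its values on the image of [cdom]
   matter. *)
Record chart (R : realType) (n : nat) (M : Type) := Chart {
  cdom : set M;
  coord : M -> 'rV[R]_n.+1;
  param : 'rV[R]_n.+1 -> M }.

Section Charts.
Context {R : realType} {n : nat} {M : topologicalType}.
Implicit Types c : chart R n M.

Definition cimage c : set 'rV[R]_n.+1 := coord c @` cdom c.

Definition is_chart c : Prop :=
  [/\ open (cdom c),
      exists2 W, open W & cimage c = W `&` halfspace,
      forall q, cdom c q -> param c (coord c q) = q,
      {within cdom c, continuous (coord c)} &
      {within cimage c, continuous (param c)}].

Definition smooth_transition c c' : Prop :=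
  forall i, smooth_on (coord c @` (cdom c `&` cdom c'))
                      (fun x => coord c' (param c x) 0 i).

Definition compatible c c' : Prop :=
  smooth_transition c c' /\ smooth_transition c' c.

End Charts.

(* The smooth structure is given by its maximal atlas. *)
Record bmanifold (R : realType) (n : nat) := BManifold {
  carrier :> topologicalType;
  atlas : set (chart R n carrier);
  bm_hausdorff : hausdorff_space carrier;
  bm_second_countable : @second_countable carrier;
  atlas_chart : forall c, atlas c -> is_chart c;
  atlas_cover : forall q, exists2 c, atlas c & cdom c q;
  atlas_compatible : forall c c', atlas c -> atlas c' -> compatible c c';
  atlas_maximal : forall c, is_chart c ->
    (forall c', atlas c' -> compatible c c') -> atlas c }.

Section Geometry.
Context {R : realType} {n : nat} (M : bmanifold R n).

Definition bdry : set M :=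
  [set q | exists c, [/\ atlas c, cdom c q & coord c q 0 0 = 0]].

Definition smooth_fun (U : set M) (f : M -> R) : Prop :=
  forall c, atlas c -> smooth_on (coord c @` (U `&` cdom c)) (f \o param c).

Definition smooth_map (phi : M -> M) : Prop :=
  continuous phi /\
  forall c, atlas c -> forall i,
    smooth_fun (phi @^-1` cdom c) (fun q => coord c (phi q) 0 i).

(* A vector field is represented by its action on functions.  Only the action
   on functions smooth on an open subset of its domain is meaningful; [vf_eq]
   is equality of vector fields on U. *)
Definition operator : Type := (M -> R) -> (M -> R).

Definition vf_eq (U : set M) (X Y : operator) : Prop :=
  forall V f, open V -> V `<=` U -> smooth_fun V f ->
  forall q, V q -> X f q = Y f q.

Definition coord_field (c : chart R n M) (i : 'I_n.+1) : operator :=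
  fun f q => hpartial i (f \o param c) (coord c q).

Definition vf_add (X Y : operator) : operator := fun f q => X f q + Y f q.

Definition vf_scale (a : M -> R) (X : operator) : operator :=
  fun f q => a q * X f q.

Definition vf_bracket (X Y : operator) : operator :=
  fun f q => X (Y f) q - Y (X f) q.

Definition vector_field (U : set M) (X : operator) : Prop :=
  forall c, atlas c -> exists a : 'I_n.+1 -> M -> R,
    (forall i, smooth_fun (U `&` cdom c) (a i)) /\
    vf_eq (U `&` cdom c) X (fun f q => \sum_i a i q * coord_field c i f q).

Definition one_form (omega : operator -> M -> R) : Prop :=
  forall U : set M, open U ->
  [/\ forall X, vector_field U X -> smooth_fun U (omega X),
      forall X X', vector_field U X -> vector_field U X' -> vf_eq U X X' ->
        forall q, U q -> omega X q = omega X' q &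
      forall a X X', smooth_fun U a -> vector_field U X -> vector_field U X' ->
        forall q, U q ->
          omega (vf_add (vf_scale a X) X') q = a q * omega X q + omega X' q].

(* Connections act on vector fields defined on arbitrary open subsets; the
   compatibility with [vf_eq] on every open U is the compatibility with
   restrictions. *)
Definition affine_connection (nabla : operator -> operator -> operator) : Prop :=
  forall U : set M, open U ->
  [/\ forall X Y, vector_field U X -> vector_field U Y ->
        vector_field U (nabla X Y),
      forall X X' Y Y', vector_field U X -> vector_field U X' ->
        vector_field U Y -> vector_field U Y' ->
        vf_eq U X X' -> vf_eq U Y Y' -> vf_eq U (nabla X Y) (nabla X' Y'),
      forall a X X' Y, smooth_fun U a ->
        vector_field U X -> vector_field U X' -> vector_field U Y ->
        vf_eq U (nabla (vf_add (vf_scale a X) X') Y)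
                (vf_add (vf_scale a (nabla X Y)) (nabla X' Y)),
      forall X Y Y',
        vector_field U X -> vector_field U Y -> vector_field U Y' ->
        vf_eq U (nabla X (vf_add Y Y')) (vf_add (nabla X Y) (nabla X Y')) &
      forall a X Y, smooth_fun U a -> vector_field U X -> vector_field U Y ->
        vf_eq U (nabla X (vf_scale a Y))
                (vf_add (vf_scale (X a) Y) (vf_scale a (nabla X Y)))].

Definition torsion_free (nabla : operator -> operator -> operator) : Prop :=
  forall U X Y, open U -> vector_field U X -> vector_field U Y ->
  vf_eq U (nabla X Y) (vf_add (nabla Y X) (vf_bracket X Y)).

Definition proj_equiv (nabla nabla' : operator -> operator -> operator) : Prop :=
  exists2 Ups : operator -> M -> R, one_form Ups &
  forall U X Y, open U -> vector_field U X -> vector_field U Y ->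
  vf_eq U (nabla' X Y)
    (vf_add (nabla X Y) (vf_add (vf_scale (Ups X) Y) (vf_scale (Ups Y) X))).

Definition projective_structure
    (P : set (operator -> operator -> operator)) : Prop :=
  exists nabla, [/\ affine_connection nabla, torsion_free nabla &
    P = [set nabla' | [/\ affine_connection nabla', torsion_free nabla' &
                         proj_equiv nabla nabla']]].

(* psi is the inverse of phi *)
Definition pushforward (phi psi : M -> M) (X : operator) : operator :=
  fun f q => X (f \o phi) (psi q).

Definition pullback_connection (phi psi : M -> M)
    (nabla : operator -> operator -> operator) :=
  fun X Y : operator =>
    pushforward psi phi (nabla (pushforward phi psi X) (pushforward phi psi Y)).

Definition projective_transformation
    (P : set (operator -> operator -> operator)) (phi : M -> M) : Prop :=
  exists psi : M -> M,
    [/\ cancel phi psi, cancel psi phi, smooth_map phi, smooth_map psi &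
        forall nabla, P nabla -> proj_equiv nabla (pullback_connection phi psi nabla)].

(* Covectors at q are given by their components in the basis dx^k of c. *)
Definition differential (c : chart R n M) (f : M -> R) (q : M) : 'rV[R]_n.+1 :=
  \row_k coord_field c k f q.

Definition rfun (c : chart R n M) (q : M) : R := coord c q 0 0.

Definition boundary_chart (c : chart R n M) : Prop :=
  [/\ atlas c,
      bdry `&` cdom c = [set q | cdom c q /\ rfun c q = 0] &
      forall q, bdry q -> cdom c q -> differential c (rfun c) q != 0].

(* The components Gamma^i_jk = dx^i(nabla_{d_j} d_k) *)
Definition christoffel (nabla : operator -> operator -> operator)
    (c : chart R n M) (i j k : 'I_n.+1) (q : M) : R :=
  nabla (coord_field c j) (coord_field c k) (fun q' => coord c q' 0 i) q.

(* The dimension is n+1, hence the factor 1/(n+2). *)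
Definition thomas (nabla : operator -> operator -> operator)
    (c : chart R n M) (i j k : 'I_n.+1) (q : M) : R :=
  christoffel nabla c i j k q
  - n.+2%:R^-1 * (\sum_l christoffel nabla c l l k q) * (i == j)%:R
  - n.+2%:R^-1 * (\sum_l christoffel nabla c l l j q) * (i == k)%:R.

Definition thomas_form (nabla : operator -> operator -> operator)
    (c : chart R n M) (i j : 'I_n.+1) (q : M) : 'rV[R]_n.+1 :=
  \row_k thomas nabla c i j k q.

Definition boundary_rigid (P : set (operator -> operator -> operator)) : Prop :=
  [set phi : M -> M | projective_transformation P phi /\
                      forall q, bdry q -> phi q = q] = [set id].

End Geometry.

Arguments bdry {R n} M.

(* Main.v *)
(** Let [phi] be a projective transformation fixing the boundary, [F] its
    expression in the chart, [G] the Christoffel symbols and [U] the 1-form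
    relating the connection to its pullback.  Then
      d_j d_k F^i = d_l F^i G^l_jk + d_j F^i U_k + d_k F^i U_j
                    - G^i_lm(F) d_j F^l d_k F^m.
    On the boundary F is the identity, so only the normal derivatives d_0 F^i
    and U are unknown there.  The hypothesis says G^0_{nu mu}(p) <> 0 for some
    tangential nu, mu (the boundary is not totally geodesic at p); reading the
    equation successively for (j,k) tangential, mixed and with i = 0, and
    mixed with i = j, forces d_0 F^0 = 1, U_tangential = 0, d_0 F^i = 0 and
    U_0 = 0 near p, i.e. F has the 1-jet of the identity and U vanishes.

    Let u = (F - id, dF - 1, U).  Modulo O(|u|) the second derivatives of F
    vanish, and differentiating the equation once more gives
      d_m d_j d_k F^i = delta^i_j d_m U_k + delta^i_k d_m U_j + O(|u|).
    Symmetry in (m, j) and dimension at least 2 give dU = O(|u|), hence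
    du = O(|u|), and by Gronwall's inequality along segments u vanishes near
    any point close to a zero of u.  So the interior of the fixed set of
    [phi] is closed as well as open, and it contains p. *)
Require Import Defs.
From HB Require Import structures.
From mathcomp Require Import all_boot all_order all_algebra.
From mathcomp Require Import all_classical all_reals all_analysis.
From mathcomp Require Import ring lra.
Import Order.TTheory GRing.Theory Num.Theory.
Import numFieldNormedType.Exports.
Local Open Scope classical_set_scope.
Local Open Scope ring_scope.

(** * Functions of class C^k *)

(** The equation says nothing about dU, so it is not a closed system in (F, dF, U). For uniqueness
    only an estimate |du| <= C |u| is needed, and working modulo O(|u|) gives it without writing the
    prolonged system out. The obstacle is that F, G and U live on the half-space while p lies on its
    edge. They are replaced by smooth extensions to full neighbourhoods. The equation then holds at
    points of the half-space only, yet it may be differentiated there, because partial derivatives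
    at such points are determined by values on the half-space. The extensions are otherwise
    arbitrary, so negligible germs are tested on the half-space only, and Gronwall's inequality runs
    along segments inside it, by convexity. At the boundary, each first-order identity is proved on
    a whole neighbourhood in the boundary. Differentiating it tangentially makes further second
    derivatives vanish, and these are the left-hand sides that the next reading of the equation
    needs. The radius of rigidity around a fixed point x0 does not depend on the zero z of u. This
    lets z be chosen afterwards, arbitrarily close to a limit point of the fixed set. *)

Section Calculus.
Context {R : realType} {n : nat}.
Local Notation E := 'rV[R]_n.+1.
Implicit Types (W : set E) (f g : E -> R) (x v : E) (F : E -> E).

Lemma entry_le_norm v i : `|v 0 i| <= `|v|.
Proof.
rewrite [leRHS]/Num.Def.normr/= mx_normrE.
exact: (le_bigmax _ (fun ij : 'I_1 * 'I_n.+1 => `|v ij.1 ij.2|) (0, i)).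
Qed.

Lemma norm_le_entries v (e : R) : 0 <= e -> (forall i, `|v 0 i| <= e) -> `|v| <= e.
Proof.
move=> e0 ve; rewrite [leLHS]/Num.Def.normr/= mx_normrE.
by apply: bigmax_le => // -[i j] _ /=; rewrite ord1.
Qed.

Lemma is_derive_line f x v (s : R) : derivable f (x + s *: v) v ->
  is_derive s (1 : R) (fun t => f (x + t *: v)) ('D_v f (x + s *: v)).
Proof.
move=> fv.
have -> : (fun t : R => f (x + t *: v)) =
          (fun t : R => f (t *: v + x)) by apply/funext => t; rewrite addrC.
have eq : (fun h : R => h^-1 *: (((fun t : R => f (t *: v + x)) \o shift s) (h *: 1) -
              (fun t : R => f (t *: v + x)) s)) =
   (fun h : R => h^-1 *: ((f \o shift (x + s *: v)) (h *: v) - f (x + s *: v))).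
  apply/funext => h /=; congr (_ *: (f _ - f _)); last by rewrite addrC.
  by rewrite /shift /= [h *: 1]mulr1 scalerDl -addrA [x + _]addrC.
by apply: DeriveDef; rewrite /derivable /derive eq.
Qed.

(** Locating [s] only by [|s| <= |h|] lets one statement serve both signs of [h]. *)
Lemma MVT_line f x v (h : R) :
  (forall s, `|s| <= `|h| -> derivable f (x + s *: v) v) ->
  exists2 s, `|s| <= `|h| & f (x + h *: v) - f x = h * 'D_v f (x + s *: v).
Proof.
move=> fv; pose g t := f (x + t *: v).
have dg s : `|s| <= `|h| -> is_derive s (1 : R) g ('D_v f (x + s *: v)).
  by move=> sh; apply: is_derive_line; exact: fv.
have cg s : `|s| <= `|h| -> {for s, continuous g}.
  move=> sh; apply/differentiable_continuous/derivable1_diffP.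
  by have [] := dg s sh.
have g0 : g 0 = f x by rewrite /g scale0r addr0.
have [h0|h0] := leP 0 h.
  have sh s : s \in `[0, h]%R -> `|s| <= `|h|.
    by rewrite in_itv /= => /andP[s0 sh]; rewrite !ger0_norm.
  have [||s /sh] := @MVT_segment R g (fun s => 'D_v f (x + s *: v)) 0 h h0.
  - by move=> s /subset_itv_oo_cc /sh; exact: dg.
  - by apply: continuous_in_subspaceT => s; rewrite inE /= => /sh; exact: cg.
  - by move=> s0 eq; exists s => //; rewrite -g0 eq subr0 mulrC.
have sh s : s \in `[h, 0]%R -> `|s| <= `|h|.
  rewrite in_itv /= => /andP[s0 sh]; rewrite !ler0_norm ?lerN2 //.
  exact: ltW.
have [||s /sh] := @MVT_segment R g (fun s => 'D_v f (x + s *: v)) h 0 (ltW h0).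
- by move=> s /subset_itv_oo_cc /sh; exact: dg.
- by apply: continuous_in_subspaceT => s; rewrite inE /= => /sh; exact: cg.
- move=> s0 eq; exists s => //.
  by rewrite -g0 -opprB eq sub0r mulrN opprK mulrC.
Qed.

Lemma derive_sum_coord f x v : differentiable f x ->
  'D_v f x = \sum_i v 0 i * 'D_(evec i) f x.
Proof.
move=> df; rewrite deriveE// [in LHS](row_sum_delta v) linear_sum /=.
by apply: eq_bigr => i _; rewrite linearZ /= -deriveE.
Qed.

Local Notation trunc h k := (\row_i (if (i < k)%N then h 0 i else 0) : E).

(* Telescoping over the coordinates, one mean value theorem per step. *)
Lemma C1_increment f x (r e : R) : 0 <= e ->
  (forall i y, `|y| < r -> derivable f (x + y) (evec i)) ->
  (forall i y, `|y| < r -> `|'D_(evec i) f (x + y) - 'D_(evec i) f x| <= e) ->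
  forall h, `|h| < r ->
  `|f (x + h) - f x - \sum_i h 0 i * 'D_(evec i) f x| <= n.+1%:R * e * `|h|.
Proof.
move=> e0 fd fe h hr.
pose u k : R := f (x + trunc h k).
have -> : f x = u 0%N.
  by rewrite /u; congr f; rewrite -[LHS]addr0; congr (_ + _); apply/rowP => i; rewrite !mxE.
have -> : f (x + h) = u n.+1.
  by rewrite /u; congr (f (_ + _)); apply/rowP => i; rewrite !mxE ltn_ord.
rewrite -(telescope_sumr u (leq0n _)) big_mkord -sumrB.
apply: (le_trans (ler_norm_sum _ _ _)).
have -> : n.+1%:R * e * `|h| = \sum_(i < n.+1) e * `|h|.
  by rewrite sumr_const card_ord -[RHS]mulr_natl mulrA.
apply: ler_sum => i _.
have step : trunc h i.+1 = trunc h i + h 0 i *: evec i.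
  apply/rowP => j; rewrite !mxE eqxx /= ltnS leq_eqVlt.
  have [ji|ji] := eqVneq j i; first by rewrite -ji !eqxx /= ltnn mulr1 add0r.
  by rewrite (_ : (j == i :> nat) = false) /= ?mulr0 ?addr0//; exact/negbTE.
have small s : `|s| <= `|h 0 i| -> `|trunc h i + s *: evec i| < r.
  move=> sh; apply: le_lt_trans hr; apply: norm_le_entries => // j.
  rewrite !mxE eqxx /=; have [->|ji] := eqVneq j i.
    by rewrite ltnn mulr1 add0r (le_trans sh)// entry_le_norm.
  by rewrite mulr0 addr0; case: ifP => _; rewrite ?normr0// entry_le_norm.
have [s|s sh eq] := @MVT_line f (x + trunc h i) (evec i) (h 0 i).
  by move=> /small; rewrite -addrA; exact: fd.
rewrite /u step addrA eq -mulrBr normrM mulrC.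
by apply: ler_pM => //; [rewrite -addrA; exact/fe/small|exact: entry_le_norm].
Qed.

Lemma C1_differentiable W f x : open W -> W x ->
  (forall i y, W y -> derivable f y (evec i)) ->
  (forall i, continuous_at x ('D_(evec i) f)) -> differentiable f x.
Proof.
move=> oW Wx fd fc.
pose L v := \sum_i v 0 i * 'D_(evec i) f x.
have Llin : linear L.
  move=> a u v; rewrite /L scaler_sumr -big_split /=; apply: eq_bigr => i _.
  by rewrite !mxE mulrDl -mulrA.
pose LM := GRing.isLinear.Build _ _ _ _ _ Llin.
pose LL : {linear E -> R} := HB.pack L LM.
have Lc : continuous LL.
  move=> v; apply: differentiable_continuous.
  have -> : LL = \sum_i (fun v : E => v 0 i * 'D_(evec i) f x) :> (E -> R).
    by apply/funext => w; rewrite fct_sumE.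
  apply: differentiable_sum => i; apply: differentiableM; first exact: differentiable_coord.
  exact: differentiable_cst.
have key : f \o shift x = cst (f x) + LL +o_ (0 : E) id.
  apply/eqaddoP => e e0.
  have N0 : (0 : R) < n.+1%:R by [].
  (* [C1_increment] makes one error per coordinate, hence the tolerance [e / n.+1%:R]. *)
  have : \forall y \near x, W y /\ forall i, `|'D_(evec i) f x - 'D_(evec i) f y| <= e / n.+1%:R.
    apply: filterI; first exact: open_nbhs_nbhs.
    pose P i y := `|'D_(evec i) f x - 'D_(evec i) f y| <= e / n.+1%:R.
    apply: (@filter_forall _ _ P (nbhs x) _) => i.
    by have /cvgrPdist_le := fc i; apply; rewrite divr_gt0.
  move=> /nbhs_ballP[r /= r0 H].
  have Hy y : `|y| < r -> W (x + y) /\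
      forall i, `|'D_(evec i) f x - 'D_(evec i) f (x + y)| <= e / n.+1%:R.
    move=> yr; apply: H; rewrite -ball_normE /ball_ /=.
    by rewrite opprD addrA subrr sub0r normrN.
  apply/nbhs_ballP; exists r => //= h.
  rewrite -ball_normE /ball_ /= sub0r normrN => hr.
  have e0' : 0 <= e / n.+1%:R by rewrite divr_ge0// ltW.
  have := @C1_increment f x r (e / n.+1%:R) e0' _ _ h hr.
  rewrite [n.+1%:R * _]mulrC divfK ?gt_eqF// => C.
  rewrite [x + h]addrC -addrA -opprD in C; apply: C => i y yr.
    exact: fd (Hy y yr).1.
  by rewrite distrC; exact: (Hy y yr).2.
by apply/diff_locallyP; rewrite (diff_unique Lc key).
Qed.

Lemma differentiable_row F x :
  (forall l, differentiable (fun y => F y 0 l) x) -> differentiable F x.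
Proof.
move=> dF.
have -> : F = \sum_l (fun y => F y 0 l *: evec l).
  by apply/funext => y; rewrite fct_sumE [LHS]row_sum_delta.
by apply: differentiable_sum => l; exact: differentiableZl.
Qed.

Lemma continuous_row F x :
  (forall l, continuous_at x (fun y => F y 0 l)) -> continuous_at x F.
Proof.
move=> cF; apply/(@cvgrPdist_le _ _ _ (nbhs x)) => e e0; near=> y.
apply: norm_le_entries => [|i]; first exact: ltW.
rewrite !mxE; move: i; near: y.
apply: (@filter_forall _ _ (fun i y => `|F x 0 i - F y 0 i| <= e) (nbhs x)) => i.
by have /(@cvgrPdist_le _ _ _ (nbhs x)) := cF i; apply.
Unshelve. all: by end_near. Qed.

Lemma derive_comp F g x v :
  (forall l, differentiable (fun y => F y 0 l) x) -> differentiable g (F x) ->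
  'D_v (g \o F) x =
  \sum_l 'D_(evec l) g (F x) * 'D_v (fun y => F y 0 l) x.
Proof.
move=> dF dg; have DF := differentiable_row F x dF.
rewrite deriveE; last exact: differentiable_comp.
rewrite diff_comp//= -deriveE// -deriveE// derive_sum_coord//.
rewrite derive_mx; last exact: diff_derivable.
by apply: eq_bigr => l _; rewrite mxE mulrC.
Qed.

Lemma Ck_continuous k W f x : Ck k W f -> W x -> continuous_at x f.
Proof. by case: k => [|k] [cf _] /cf. Qed.

Lemma Ck_pred k W f : Ck k.+1 W f -> Ck k W f.
Proof.
elim: k f => [|k IH] f [cf df]; split => // i; split; first by move=> *; apply: (df i).1.
exact/IH/(df i).2.
Qed.

Lemma Ck_sub k W W' f : W' `<=` W -> Ck k W f -> Ck k W' f.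
Proof.
move=> W'W; elim: k f => [|k IH] f [cf df]; split => //.
- by move=> x /W'W /cf.
- by move=> x /W'W /cf.
- move=> i; split; last exact: IH (df i).2.
  by move=> x /W'W /(df i).1.
Qed.

Lemma Ck_ext k W f g : open W -> (forall x, W x -> f x = g x) ->
  Ck k W f -> Ck k W g.
Proof.
move=> oW; elim: k f g => [|k IH] f g fg [cf df].
  split=> // x Wx; have nfg : {near x, f =1 g}.
    by apply: filterS (open_nbhs_nbhs (conj oW Wx)) => y /fg.
  by rewrite /continuous_at -(fg x Wx); apply: cvg_trans (cf x Wx);
    apply: (@near_eq_cvg _ _ (nbhs x)).
have nfg x : W x -> {near x, f =1 g}.
  by move=> Wx; apply: filterS (open_nbhs_nbhs (conj oW Wx)) => y /fg.
split=> [x Wx|i].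
  by rewrite /continuous_at -(fg x Wx); apply: cvg_trans (cf x Wx);
    apply: (@near_eq_cvg _ _ (nbhs x)); exact: nfg.
split=> [x Wx|].
  by apply: near_eq_derivable ((df i).1 x Wx); exact: nfg.
by apply: IH (df i).2 => x Wx; exact/near_eq_derive/nfg.
Qed.

Lemma Ck_differentiable k W f x : open W -> Ck k.+1 W f -> W x -> differentiable f x.
Proof.
move=> oW [cf df] Wx; apply: (@C1_differentiable W) => // [i y Wy|i].
  by move=> *; apply: (df i).1.
exact: Ck_continuous (df i).2 Wx.
Qed.

Lemma Ck_cst k W (a : R) : Ck k W (fun=> a).
Proof.
elim: k a => [|k IH] a; split=> //; try by move=> x _; exact: cst_continuous.
move=> i; split=> [x _|]; first exact: derivable_cst.
have -> : (fun x => 'D_(evec i) (fun=> a) x) = fun _ : E => 0 :> R.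
  by apply/funext => x; exact: derive_cst.
exact: IH.
Qed.

Lemma is_derive_coord i v x : is_derive x v (fun y : E => y 0 i) (v 0 i).
Proof.
have d : derivable (fun y : E => y 0 i) x v by exact/diff_derivable/differentiable_coord.
apply: DeriveDef => //.
have := @derive_mx R E 1 n.+1 id x v (@derivable_id _ _ _ _).
by rewrite derive_id => /rowP/(_ i); rewrite mxE.
Qed.

Lemma Ck_coord k W i : Ck k W (fun x => x 0 i).
Proof.
case: k => [|k]; split=> //; try by move=> x _; exact: coord_continuous.
move=> j; split=> [x _|]; first by have [] := is_derive_coord i (evec j) x.
have -> : (fun x => 'D_(evec j) (fun y : E => y 0 i) x) = fun=> (evec j : E) 0 i.
  by apply/funext => x; have [_ ->] := is_derive_coord i (evec j) x.
exact: Ck_cst.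
Qed.

Lemma CkD k W f g : open W -> Ck k W f -> Ck k W g -> Ck k W (fun x => f x + g x).
Proof.
move=> oW; elim: k f g => [|k IH] f g [cf df] [cg dg]; split=> //;
  try by move=> x Wx; apply: (@cvgD _ _ _ (nbhs x)); [exact: cf|exact: cg].
move=> i; split=> [x Wx|].
  by apply: derivableD; [exact: (df i).1|exact: (dg i).1].
apply: Ck_ext (IH _ _ (df i).2 (dg i).2) => // x Wx.
by rewrite -deriveD//; [exact: (df i).1|exact: (dg i).1].
Qed.

Lemma CkM k W f g : open W -> Ck k W f -> Ck k W g -> Ck k W (fun x => f x * g x).
Proof.
move=> oW; elim: k f g => [|k IH] f g Cf Cg; have [cf df] := Cf; have [cg dg] := Cg; split=> //;
  try by move=> x Wx; apply: (@cvgM _ _ (nbhs x)); [exact: cf|exact: cg].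
move=> i; split=> [x Wx|].
  by apply: derivableM; [exact: (df i).1|exact: (dg i).1].
have Cf' := Ck_pred _ _ _ Cf; have Cg' := Ck_pred _ _ _ Cg.
apply: Ck_ext (CkD _ _ _ _ oW (IH _ _ Cf' (dg i).2) (IH _ _ Cg' (df i).2)) => // x Wx.
by rewrite -deriveM//; [exact: (df i).1|exact: (dg i).1].
Qed.

Lemma Ck_sum k W (I : Type) (r : seq I) (f : I -> E -> R) : open W ->
  (forall i, Ck k W (f i)) -> Ck k W (fun x => \sum_(i <- r) f i x).
Proof.
move=> oW Cf; elim: r => [|i r IH].
  by under eq_fun do rewrite big_nil; exact: Ck_cst.
by under eq_fun do rewrite big_cons; exact: CkD.
Qed.

Lemma Ck_comp k W W' g F : open W -> open W' -> (forall x, W x -> W' (F x)) ->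
  (forall l, Ck k W (fun x => F x 0 l)) -> Ck k W' g -> Ck k W (g \o F).
Proof.
move=> oW oW' FW; elim: k g => [|k IH] g CF Cg.
  split=> // x Wx; apply: (@continuous_comp _ _ _ F g); last exact: Cg.1 (FW x Wx).
  by apply: continuous_row => l; exact: (CF l).1.
have dF x l : W x -> differentiable (fun x => F x 0 l) x.
  by move=> Wx; exact: (Ck_differentiable _ _ _ _ oW (CF l) Wx).
have dg x : W x -> differentiable g (F x).
  by move=> Wx; exact: (Ck_differentiable _ _ _ _ oW' Cg (FW _ Wx)).
have DF x : W x -> differentiable F x by move=> Wx; apply: differentiable_row => l; exact: dF.
have dgF x : W x -> differentiable (g \o F) x.
  by move=> Wx; apply: differentiable_comp; [exact: DF|exact: dg].
split=> [x Wx|i]; first exact/differentiable_continuous/dgF.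
split=> [x Wx|]; first exact/diff_derivable/dgF.
pose D x := \sum_l ('D_(evec l) g \o F) x * 'D_(evec i) (fun y => F y 0 l) x.
apply: (@Ck_ext _ W D) => //.
  by move=> x Wx; rewrite derive_comp//; [move=> l; exact: dF|exact: dg].
apply: Ck_sum => // l; apply: CkM => //; last exact: ((CF l).2 i).2.
by apply: IH => [m|]; [exact/Ck_pred|exact: (Cg.2 l).2].
Qed.

End Calculus.

(** * Smooth functions and one-sided derivatives *)

Section SmoothOpen.
Context {R : realType} {n : nat}.
Local Notation E := 'rV[R]_n.+1.
Implicit Types (W : set E) (f g : E -> R) (x v : E) (F : E -> E).

Lemma smooth_open_sub W W' f : W' `<=` W -> smooth_open W f -> smooth_open W' f.
Proof. by move=> W'W sf k; exact: Ck_sub (sf k). Qed.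

Lemma smooth_open_cst W (a : R) : smooth_open W (fun=> a).
Proof. by move=> k; exact: Ck_cst. Qed.

Lemma smooth_open_coord W i : smooth_open W (fun x => x 0 i).
Proof. by move=> k; exact: Ck_coord. Qed.

Lemma smooth_openD W f g : open W -> smooth_open W f -> smooth_open W g ->
  smooth_open W (fun x => f x + g x).
Proof. by move=> oW sf sg k; exact: CkD. Qed.

Lemma smooth_openM W f g : open W -> smooth_open W f -> smooth_open W g ->
  smooth_open W (fun x => f x * g x).
Proof. by move=> oW sf sg k; exact: CkM. Qed.

Lemma smooth_open_comp W W' g F : open W -> open W' -> (forall x, W x -> W' (F x)) ->
  (forall l, smooth_open W (fun x => F x 0 l)) -> smooth_open W' g ->
  smooth_open W (g \o F).
Proof.
move=> oW oW' FW sF sg k.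
by apply: (@Ck_comp _ _ k W W') => // l; exact: sF.
Qed.

Lemma smooth_open_derive W f i : smooth_open W f -> smooth_open W ('D_(evec i) f).
Proof. by move=> sf k; have [_ /(_ i) []] := sf k.+1. Qed.

Lemma smooth_open_differentiable W f x : open W -> smooth_open W f -> W x ->
  differentiable f x.
Proof. by move=> oW sf; exact: (@Ck_differentiable _ _ 0 W). Qed.

Lemma smooth_open_continuous W f x : smooth_open W f -> W x -> continuous_at x f.
Proof. by move=> sf; exact: (@Ck_continuous _ _ 0 W). Qed.

Lemma smooth_open_derivable W f x i : smooth_open W f -> W x ->
  derivable f x (evec i).
Proof. by move=> sf Wx; have [_ /(_ i) [+ _]] := sf 1%N; exact. Qed.

Lemma norm_evec (i : 'I_n.+1) : `|evec i : E| <= 1.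
Proof.
apply: norm_le_entries => // j; rewrite mxE eqxx /=.
by case: eqP => _; rewrite ?normr1 ?normr0.
Qed.

Lemma growth_shift f x v a :
  (fun h : R => h^-1 *: (((fun y => f (y + a)) \o shift x) (h *: v) - f (x + a))) =
  (fun h : R => h^-1 *: ((f \o shift (x + a)) (h *: v) - f (x + a))).
Proof. by apply/funext => h /=; rewrite addrA. Qed.

Lemma derivable_shift f x v a : derivable f (x + a) v ->
  derivable (fun y => f (y + a)) x v.
Proof. by rewrite /derivable growth_shift. Qed.

Lemma derive_translate f x v a : 'D_v (fun y => f (y + a)) x = 'D_v f (x + a).
Proof. by rewrite /derive growth_shift. Qed.

(** Two mean value theorems: along [evec i] for the increment of [f] in direction [j], then along
    [evec j] for the derivative so obtained. The left-hand side is symmetric in [i] and [j], the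
    right-hand side is not visibly so. *)
Lemma second_difference W f x i j (h : R) : smooth_open W f ->
  (forall s t : R, `|s| <= `|h| -> `|t| <= `|h| -> W (x + s *: evec i + t *: evec j)) ->
  exists s t, [/\ `|s| <= `|h|, `|t| <= `|h| &
    f (x + h *: evec i + h *: evec j) - f (x + h *: evec j)
      - (f (x + h *: evec i) - f x) =
    h * (h * 'D_(evec j) ('D_(evec i) f) (x + s *: evec i + t *: evec j))].
Proof.
move=> sf Wst.
have W0 s : `|s| <= `|h| -> W (x + s *: evec i).
  by move=> sh; have := Wst s 0 sh; rewrite normr0 scale0r addr0; exact.
pose g y := f (y + h *: evec j) - f y.
have dgs s : `|s| <= `|h| -> derivable (fun y => f (y + h *: evec j)) (x + s *: evec i) (evec i).
  by move=> sh; apply: derivable_shift; apply: (smooth_open_derivable _ _ _ _ sf); exact: Wst.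
have df s : `|s| <= `|h| -> derivable f (x + s *: evec i) (evec i).
  by move=> sh; apply: (smooth_open_derivable _ _ _ _ sf); exact: W0.
have [s sh|s sh eqs] := @MVT_line R n g x (evec i) h.
  by apply: derivableB; [exact: dgs|exact: df].
have [t th|t th eqt] := @MVT_line R n ('D_(evec i) f) (x + s *: evec i) (evec j) h.
  by apply: (smooth_open_derivable _ _ _ _ (smooth_open_derive _ _ i sf)); exact: Wst.
exists s, t; split=> //.
rewrite -eqt; have -> : 'D_(evec i) f (x + s *: evec i + h *: evec j) -
    'D_(evec i) f (x + s *: evec i) = 'D_(evec i) g (x + s *: evec i).
  rewrite /g (@deriveB _ _ _ (fun y => f (y + h *: evec j)) f); [|exact: dgs|exact: df].
  by rewrite derive_translate.
by rewrite -eqs /g; ring.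
Qed.

Lemma dist_halves (a b p q e : R) :
  q = p -> `|a - p| <= e / 2 -> `|b - q| <= e / 2 -> `|a - b| <= e.
Proof.
move=> -> ap bp; rewrite (splitr e) -(subrKA p); apply: (le_trans (ler_normD _ _)).
by rewrite lerD// distrC.
Qed.

(** By symmetry of the second difference, the two mixed derivatives agree at some pair of points
    close to [x]. Continuity at [x] compares them there up to [e], so a single step [h] for each [e]
    is enough. *)
Lemma derive_sym W f x i j : open W -> smooth_open W f -> W x ->
  'D_(evec i) ('D_(evec j) f) x = 'D_(evec j) ('D_(evec i) f) x.
Proof.
move=> oW sf Wx.
apply/eqP; rewrite -subr_eq0 -normr_le0; 
suff H (e : R) : 0 < e ->
    `|'D_(evec i) ('D_(evec j) f) x - 'D_(evec j) ('D_(evec i) f) x| <= e.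
  by apply/ler_addgt0Pr => e e0; rewrite add0r; exact: H.
move=> e0.
pose close k l y := `|'D_(evec k) ('D_(evec l) f) x - 'D_(evec k) ('D_(evec l) f) y| <= e / 2.
have nc k l : \forall y \near x, close k l y.
  have c := smooth_open_continuous _ _ x
    (smooth_open_derive _ _ k (smooth_open_derive _ _ l sf)) Wx.
  have /(@cvgrPdist_le _ _ _ (nbhs x)) cx := c.
  by apply: (cx (e / 2)); rewrite divr_gt0.
have /nbhs_ballP[r /= r0 rP] : \forall y \near x, W y /\ (close i j y /\ close j i y).
  apply: (@filterI _ (nbhs x)); first exact: open_nbhs_nbhs.
  by apply: (@filterI _ (nbhs x)); exact: nc.
(* Two displacements of length at most [h] stay within [r / 2] of [x]. *)
pose h := r / 4.
have h0 : 0 < h by rewrite divr_gt0.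
have Bst k l (s t : R) : `|s| <= `|h| -> `|t| <= `|h| ->
    ball x r (x + s *: evec k + t *: evec l).
  move=> sh th; rewrite -ball_normE /ball_ /= -addrA opprD addrA subrr sub0r normrN.
  apply: (le_lt_trans (ler_normD _ _)); rewrite !normrZ.
  have H (u : R) m : `|u| <= `|h| -> `|u| * `|evec m : E| <= h.
    move=> uh; rewrite -[leRHS]mulr1 -[in leRHS](gtr0_norm h0).
    by apply: ler_pM => //; exact: norm_evec.
  apply: (le_lt_trans (lerD (H _ _ sh) (H _ _ th))).
  rewrite /h -mulrDr; rewrite gtr_pMr//.
  by rewrite (_ : 4^-1 + 4^-1 = 2^-1 :> R) ?invf_lt1 ?ltr1n//; field.
have [s [t [sh th eq1]]] := second_difference _ _ _ i j h sf
  (fun s t sh th => (rP _ (Bst i j s t sh th)).1).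
have [s' [t' [sh' th' eq2]]] := second_difference _ _ _ j i h sf
  (fun s t sh th => (rP _ (Bst j i s t sh th)).1).
have E12 : 'D_(evec j) ('D_(evec i) f) (x + s *: evec i + t *: evec j) =
           'D_(evec i) ('D_(evec j) f) (x + s' *: evec j + t' *: evec i).
  have h0' : h != 0 by rewrite gt_eqF.
  have swap (a b c d : R) : a - b - (c - d) = a - c - (b - d) by ring.
  apply: (mulfI h0'); apply: (mulfI h0').
  apply: (etrans (esym eq1)); apply: (etrans _ eq2).
  by rewrite swap [x + h *: evec i + h *: evec j]addrAC.
have [_ [_ c1]] := rP _ (Bst i j s t sh th).
have [_ [c2 _]] := rP _ (Bst j i s' t' sh' th').
exact: (dist_halves _ _ _ _ _ E12 c2 c1).
Qed.

End SmoothOpen.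

(** * One-sided partial derivatives and smooth extensions *)

Section HalfSpaceCalculus.
Context {R : realType} {n : nat}.
Local Notation E := 'rV[R]_n.+1.
Implicit Types (W S : set E) (f g : E -> R) (x v : E) (F : E -> E).

Lemma halfspace_shift x (h : R) i : halfspace x -> 0 <= h -> halfspace (h *: evec i + x).
Proof.
rewrite /halfspace /= => x0 h0; rewrite !mxE eqxx /=.
by rewrite addr_ge0// mulr_ge0.
Qed.

Lemma hpartial_ext i f g x : halfspace x -> derivable g x (evec i) ->
  (\forall y \near x, halfspace y -> f y = g y) ->
  hpartial i f x = 'D_(evec i) g x.
Proof.
move=> Hx dg fg.
set D := [set h : R | halfspace (h *: evec i + x)].
(* Small positive [h] never leave the half-space, so the filter defining [hpartial] is proper and
   its limit is unique. *)
have PF : ProperFilter (within D (0 : R)^').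
  apply: Build_ProperFilter_ex => P; rewrite /within /=.
  move=> /nbhs_ballP[r /= r0 rP]; exists (r / 2).
  have r20 : 0 < r / 2 by rewrite divr_gt0.
  apply: rP => /=.
  - rewrite -ball_normE /ball_ /= sub0r normrN gtr0_norm// gtr_pMr//.
    by rewrite invf_lt1 ?ltr1n.
  - by rewrite gt_eqF.
  - by apply: halfspace_shift => //; exact: ltW.
rewrite /hpartial -/D; apply: cvg_lim; first exact: Rhausdorff.
have cg : (fun h : R => h^-1 * (g (h *: evec i + x) - g x)) @ within D 0^' --> 'D_(evec i) g x.
  by apply: cvg_trans dg; apply: cvg_app; exact: cvg_within.
apply: cvg_trans cg; apply: near_eq_cvg.
have fgx : f x = g x by apply: (nbhs_singleton fg).
have nfg : \forall h \near (0 : R), halfspace (h *: evec i + x) ->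
    f (h *: evec i + x) = g (h *: evec i + x).
  have c : (fun h : R => h *: evec i + x) @ (0 : R) --> x.
    rewrite -[X in _ --> X]add0r; apply: (@cvgD _ _ _ (nbhs (0 : R))); last exact: cvg_cst.
    by rewrite -[X in _ --> X](scale0r (evec i : E)); exact: scalel_continuous.
  exact: (c _ fg).
have nfg' : \forall h \near (0 : R)^', halfspace (h *: evec i + x) ->
    f (h *: evec i + x) = g (h *: evec i + x) by exact: cvg_within nfg.
by apply: filterS nfg' => h fgh Dh; rewrite fgh// fgx.
Qed.

Definition relopen S :=
  S `<=` halfspace /\ forall x, S x -> \forall y \near x, halfspace y -> S y.

Lemma smooth_on_sub S S' f : S' `<=` S -> smooth_on S f -> smooth_on S' f.
Proof.
move=> S'S sf x /S'S /sf[W [g [oW Wx sg fg]]]; exists W, g; split=> // y Wy /S'S.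
exact: fg.
Qed.

Lemma smooth_on_ext S f g : (forall x, S x -> f x = g x) -> smooth_on S f -> smooth_on S g.
Proof.
move=> fg sf x /sf[W [h [oW Wx sh fh]]]; exists W, h; split=> // y Wy Sy.
by rewrite -fg// fh.
Qed.

Lemma smooth_on_cst S (a : R) : smooth_on S (fun=> a).
Proof.
move=> x _; exists setT, (fun=> a); split=> //; first exact: openT.
exact: smooth_open_cst.
Qed.

Lemma smooth_on_coord S i : smooth_on S (fun x => x 0 i).
Proof.
move=> x _; exists setT, (fun x => x 0 i); split=> //; first exact: openT.
exact: smooth_open_coord.
Qed.

Lemma smooth_onD S f g : smooth_on S f -> smooth_on S g -> smooth_on S (fun x => f x + g x).
Proof.
move=> sf sg x Sx; have [W [f' [oW Wx sf' ff']]] := sf x Sx.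
have [W' [g' [oW' Wx' sg' gg']]] := sg x Sx.
exists (W `&` W'), (fun x => f' x + g' x); split=> //; first exact: openI.
- apply: smooth_openD; first exact: openI.
  + by apply: smooth_open_sub sf'; exact: subIsetl.
  + by apply: smooth_open_sub sg'; exact: subIsetr.
- by move=> y [Wy W'y] Sy; rewrite ff'// gg'.
Qed.

Lemma smooth_onM S f g : smooth_on S f -> smooth_on S g -> smooth_on S (fun x => f x * g x).
Proof.
move=> sf sg x Sx; have [W [f' [oW Wx sf' ff']]] := sf x Sx.
have [W' [g' [oW' Wx' sg' gg']]] := sg x Sx.
exists (W `&` W'), (fun x => f' x * g' x); split=> //; first exact: openI.
- apply: smooth_openM; first exact: openI.
  + by apply: smooth_open_sub sf'; exact: subIsetl.
  + by apply: smooth_open_sub sg'; exact: subIsetr.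
- by move=> y [Wy W'y] Sy; rewrite ff'// gg'.
Qed.

(** [smooth_on] gives every function its own neighbourhood; finiteness of [J] allows a common
    one. *)
Lemma smooth_on_family (J : finType) S (h : J -> E -> R) x :
  (forall j, smooth_on S (h j)) -> S x ->
  exists W (g : J -> E -> R), [/\ open W, W x, forall j, smooth_open W (g j) &
                             forall j y, W y -> S y -> h j y = g j y].
Proof.
move=> sh Sx.
have /choice[p pP] j : exists p : set E * (E -> R),
    [/\ open p.1, p.1 x, smooth_open p.1 p.2 & forall y, p.1 y -> S y -> h j y = p.2 y].
  by have [W [g H]] := sh j x Sx; exists (W, g).
exists (interior [set y | forall j, (p j).1 y]), (fun j => (p j).2); split.
- exact: open_interior.
- apply: (@filter_forall _ _ (fun j y => (p j).1 y) (nbhs x)) => j.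
  by have [oW Wx _ _] := pP j; exact: open_nbhs_nbhs.
- by move=> j; have [_ _ sp _] := pP j; apply: smooth_open_sub sp => y /interior_subset.
- by move=> j y /interior_subset Wy Sy; have [_ _ _] := pP j; apply => //; exact: Wy.
Qed.

Lemma smooth_on_row S F x : (forall l, smooth_on S (fun y => F y 0 l)) -> S x ->
  exists W G, [/\ open W, W x, forall l, smooth_open W (fun y => (G y : E) 0 l) &
                 forall y, W y -> S y -> F y = G y].
Proof.
move=> sF Sx; have [W [g [oW Wx sg Fg]]] := smooth_on_family _ _ _ _ sF Sx.
exists W, (fun y => \row_l g l y); split=> // [l|y Wy Sy].
  by have -> : (fun y => (\row_l g l y : E) 0 l) = g l by apply/funext => y; rewrite mxE.
by apply/rowP => l; rewrite mxE -Fg.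
Qed.

(** The extension [G] of [F] may leave the half-space, so it is composed with an extension [g] of
    [f], on the open set where [G] lands in the domain of [g]. *)
Lemma smooth_on_comp S S' F f : (forall l, smooth_on S (fun y => F y 0 l)) ->
  (forall x, S x -> S' (F x)) -> smooth_on S' f -> smooth_on S (f \o F).
Proof.
move=> sF FS sf x Sx; have [W [G [oW Wx sG FG]]] := smooth_on_row _ _ _ sF Sx.
have [W' [g [oW' Wx' sg fg]]] := sf _ (FS x Sx).
have cG y : W y -> continuous_at y G.
  by move=> Wy; apply: continuous_row => l; exact: smooth_open_continuous (sG l) Wy.
have oV : open (W `&` G @^-1` W').
  rewrite openE => y [Wy W'y]; apply: (@filterI _ (nbhs y)); first exact: open_nbhs_nbhs.
  by apply: (cG y Wy); exact: open_nbhs_nbhs.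
exists (W `&` G @^-1` W'), (g \o G); split=> //.
- by split=> //=; rewrite -FG.
- apply: (@smooth_open_comp _ _ _ W') => // [y []//|l].
  by apply: smooth_open_sub (sG l); exact: subIsetl.
- by move=> y [Wy W'y] Sy /=; rewrite FG// fg// -FG//; exact: FS.
Qed.

Lemma near_relopen S (P : set E) x : relopen S -> S x ->
  (\forall y \near x, S y -> P y) -> \forall y \near x, halfspace y -> P y.
Proof.
by move=> [_ rS] /rS nS nP; apply: filterS2 nS nP => y HS SP Hy; exact/SP/HS.
Qed.

Lemma hpartial_smooth S W f g x i : relopen S -> S x -> open W -> W x ->
  smooth_open W g -> (forall y, W y -> S y -> f y = g y) ->
  hpartial i f x = 'D_(evec i) g x.
Proof.
move=> rS Sx oW Wx sg fg; apply: hpartial_ext.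
- exact: rS.1.
- exact: smooth_open_derivable sg Wx.
- apply: near_relopen rS Sx _.
  by apply: filterS (open_nbhs_nbhs (conj oW Wx)) => y; exact: fg.
Qed.

Lemma smooth_on_hpartial S f i : relopen S -> smooth_on S f -> smooth_on S (hpartial i f).
Proof.
move=> rS sf x Sx; have [W [g [oW Wx sg fg]]] := sf x Sx.
exists W, ('D_(evec i) g); split=> //; first exact: smooth_open_derive.
by move=> y Wy Sy; apply: (hpartial_smooth S W).
Qed.

Lemma hpartial_eq S f g i x : relopen S -> S x -> (forall y, S y -> f y = g y) ->
  smooth_on S g -> hpartial i f x = hpartial i g x.
Proof.
move=> rS Sx fg sg; have [W [h [oW Wx sh gh]]] := sg x Sx.
rewrite (hpartial_smooth S W _ h)//; last by move=> y Wy Sy; rewrite fg// gh.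
by rewrite (hpartial_smooth S W _ h).
Qed.

Lemma hpartial_coord S i l x : relopen S -> S x ->
  hpartial i (fun y : E => y 0 l) x = (i == l)%:R.
Proof.
move=> rS Sx; rewrite (hpartial_smooth S setT _ (fun y => y 0 l))//; last 2 first.
- exact: openT.
- exact: smooth_open_coord.
by have [_ ->] := is_derive_coord l (evec i) x; rewrite mxE eqxx eq_sym.
Qed.

Lemma hpartial_comp S S' F f i x : relopen S -> relopen S' ->
  (forall l, smooth_on S (fun y => F y 0 l)) ->
  (forall x, S x -> S' (F x)) -> smooth_on S' f -> S x ->
  hpartial i (f \o F) x =
  \sum_l hpartial l f (F x) * hpartial i (fun y => F y 0 l) x.
Proof.
move=> rS rS' sF FS sf Sx.
have [W [G [oW Wx sG FG]]] := smooth_on_row _ _ _ sF Sx.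
have [W' [g [oW' Wx' sg fg]]] := sf _ (FS x Sx).
have cG y : W y -> continuous_at y G.
  by move=> Wy; apply: continuous_row => l; exact: smooth_open_continuous (sG l) Wy.
have oV : open (W `&` G @^-1` W').
  rewrite openE => y [Wy W'y]; apply: (@filterI _ (nbhs y)); first exact: open_nbhs_nbhs.
  by apply: (cG y Wy); exact: open_nbhs_nbhs.
have FGx : F x = G x by exact: FG.
have dG l : differentiable (fun y => G y 0 l) x.
  exact: smooth_open_differentiable oW (sG l) Wx.
rewrite (hpartial_smooth S (W `&` G @^-1` W') _ (g \o G))//; last 3 first.
- by split=> //=; rewrite -FGx.
- apply: (@smooth_open_comp _ _ _ W') => // [y []//|l].
  by apply: smooth_open_sub (sG l); exact: subIsetl.
- by move=> y [Wy W'y] Sy /=; rewrite FG// fg// -FG//; exact: FS.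
rewrite derive_comp//; last by rewrite -FGx; exact: smooth_open_differentiable sg Wx'.
apply: eq_bigr => l _; congr (_ * _).
  by rewrite FGx (hpartial_smooth S' W' _ g)// -?FGx//; exact: FS.
by rewrite (hpartial_smooth S W _ (fun y => G y 0 l))// => y Wy Sy; rewrite FG.
Qed.

End HalfSpaceCalculus.

(** * Gronwall's inequality *)

Lemma is_derive_sumr (R : realType) (V : normedModType R) (J : Type) (r : seq J)
    (h : J -> V -> R) (dh : J -> R) (x v : V) :
  (forall j, is_derive x v (h j) (dh j)) ->
  is_derive x v (fun y => \sum_(j <- r) h j y) (\sum_(j <- r) dh j).
Proof.
move=> H; elim: r => [|j r IH].
  by under eq_fun do rewrite big_nil; rewrite big_nil; exact: is_derive_cst.
by under eq_fun do rewrite big_cons; rewrite big_cons; exact: is_deriveD.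
Qed.

Section Gronwall.
Context {R : realType} {n : nat}.
Local Notation E := 'rV[R]_n.+1.
Implicit Types (W : set E) (f g : E -> R) (x v : E).

(** The integrating factor [expR (- L * t)] turns the differential inequality into [dg t <= 0], and
    one mean value theorem on [[0, 1]] compares the endpoints. *)
Lemma gronwall_segment (S : E -> R) z d (L : R) :
  (forall t : R, 0 <= t <= 1 -> derivable S (z + t *: d) d) ->
  (forall t : R, 0 <= t <= 1 -> 'D_d S (z + t *: d) <= L * S (z + t *: d)) ->
  S z <= 0 -> S (z + d) <= 0.
Proof.
move=> dS LS Sz.
pose g (t : R) := expR (- L * t) * S (z + t *: d).
pose dg (t : R) := expR (- L * t) * ('D_d S (z + t *: d) - L * S (z + t *: d)).
have itvE (t : R) : t \in `[0, 1]%R -> 0 <= t <= 1 by rewrite in_itv.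
have isd (t : R) : 0 <= t <= 1 -> is_derive t (1 : R) g (dg t).
  move=> t01; have h1 := is_derive_line _ _ _ _ (dS t t01).
  have h2 : is_derive t (1 : R) (fun t => expR (- L * t)) (- L * expR (- L * t)).
    have h3 : is_derive t (1 : R) (fun t : R => - L * t) (- L).
      apply: (is_derive_eq (is_deriveZ (- L) (is_derive_id t (1 : R)))).
      by rewrite /GRing.scale /= mulr1.
    by apply: (is_derive_eq (is_derive1_comp (is_derive_expR _) h3)); rewrite mulrC.
  have := is_deriveM h2 h1; rewrite /dg /g.
  by move=> H; apply: (is_derive_eq H); rewrite /GRing.scale /=; ring.
have [||t /itvE t01] := @MVT_segment R g dg 0 1 ler01.
- by move=> t /subset_itv_oo_cc /itvE; exact: isd.
- apply: continuous_in_subspaceT => t; rewrite inE /= => /itvE t01.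
  by apply/differentiable_continuous/derivable1_diffP; have [] := isd t t01.
- rewrite subr0 mulr1 => eq.
  have dg0 : dg t <= 0.
    rewrite /dg; apply: mulr_ge0_le0; first exact: expR_ge0.
    by rewrite subr_le0; exact: LS.
  move: eq; rewrite /g mulr1 scale1r mulr0 expR0 mul1r scale0r addr0 => eq.
  have : expR (- L) * S (z + d) <= 0.
    by rewrite -[leLHS](subrK (S z)) eq -[leRHS]addr0 lerD.
  by rewrite pmulr_rle0// expR_gt0.
Qed.

End Gronwall.

(** * Germs modulo the size of a family, and uniqueness by Gronwall *)

Section Germs.
Context {R : realType} {n : nat}.
Local Notation E := 'rV[R]_n.+1.
Variables (I : finType) (u : I -> E -> R) (x0 : E).
Implicit Types (W : set E) (f g : E -> R) (x v : E).

(* Germs at [x0] along the half-space, modulo the functions that are O of the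
   size of the family [u]. *)
Definition size_of x := \sum_a `|u a x|.

Definition negl f := exists C : R, \forall x \near x0, halfspace x -> `|f x| <= C * size_of x.

Definition bnd f := exists C : R, \forall x \near x0, halfspace x -> `|f x| <= C.

Definition eqv f g := negl (fun x => f x - g x).

Lemma size_of_ge0 x : 0 <= size_of x.
Proof. by apply: sumr_ge0. Qed.

Lemma negl_near f g : (\forall x \near x0, halfspace x -> f x = g x) -> negl f -> negl g.
Proof.
move=> fg [C fC]; exists C; move: fg fC; apply: (@filterS2 _ (nbhs x0)) => x fg fC Hx.
by rewrite -fg//; exact: fC.
Qed.

Lemma negl_u a : negl (u a).
Proof.
exists 1; apply: (@nearW _ (nbhs x0)) => x _; rewrite mul1r /size_of (bigD1 a)//=.
by rewrite lerDl sumr_ge0.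
Qed.

Lemma negl0 : negl (fun=> 0).
Proof. by exists 0; apply: (@nearW _ (nbhs x0)) => x _; rewrite normr0 mul0r. Qed.

Lemma neglD f g : negl f -> negl g -> negl (fun x => f x + g x).
Proof.
move=> [C fC] [D gD]; exists (C + D); move: fC gD.
apply: (@filterS2 _ (nbhs x0)) => x fC gD Hx.
by rewrite mulrDl (le_trans (ler_normD _ _))// lerD//; [exact: fC|exact: gD].
Qed.

Lemma bndD f g : bnd f -> bnd g -> bnd (fun x => f x + g x).
Proof.
move=> [C fC] [D gD]; exists (C + D); move: fC gD.
apply: (@filterS2 _ (nbhs x0)) => x fC gD Hx.
by rewrite (le_trans (ler_normD _ _))// lerD//; [exact: fC|exact: gD].
Qed.

Lemma neglM f g : bnd f -> negl g -> negl (fun x => f x * g x).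
Proof.
move=> [C fC] [D gD]; exists (C * D); move: fC gD.
apply: (@filterS2 _ (nbhs x0)) => x fC gD Hx.
by rewrite normrM -mulrA ler_pM//; [exact: fC|exact: gD].
Qed.

Lemma bndM f g : bnd f -> bnd g -> bnd (fun x => f x * g x).
Proof.
move=> [C fC] [D gD]; exists (C * D); move: fC gD.
apply: (@filterS2 _ (nbhs x0)) => x fC gD Hx.
by rewrite normrM ler_pM//; [exact: fC|exact: gD].
Qed.

Lemma bnd_cst (a : R) : bnd (fun=> a).
Proof. by exists `|a|; exact: (@nearW _ (nbhs x0)). Qed.

Lemma bnd_continuous f : continuous_at x0 f -> bnd f.
Proof.
move=> /(@cvgrPdist_le _ _ _ (nbhs x0)) cf; exists (1 + `|f x0|).
apply: (@filterS _ (nbhs x0) _ _ _ _ (cf 1 ltr01)) => x fx _.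
rewrite -[in leLHS](subrK (f x0) (f x)) (le_trans (ler_normD _ _))// lerD2r.
by rewrite distrC.
Qed.

Lemma bnd_sum (J : Type) (r : seq J) (f : J -> E -> R) :
  (forall j, bnd (f j)) -> bnd (fun x => \sum_(j <- r) f j x).
Proof.
move=> bf; elim: r => [|j r IH].
  by under eq_fun do rewrite big_nil; exact: bnd_cst.
by under eq_fun do rewrite big_cons; exact: bndD.
Qed.

Lemma negl_sum (J : Type) (r : seq J) (f : J -> E -> R) :
  (forall j, negl (f j)) -> negl (fun x => \sum_(j <- r) f j x).
Proof.
move=> nf; elim: r => [|j r IH].
  by under eq_fun do rewrite big_nil; exact: negl0.
by under eq_fun do rewrite big_cons; exact: neglD.
Qed.

Lemma neglZ (c : R) f : negl f -> negl (fun x => c * f x).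
Proof. by move=> nf; apply: neglM => //; exact: bnd_cst. Qed.

Lemma eqv_refl f : eqv f f.
Proof. by rewrite /eqv; under eq_fun do rewrite subrr; exact: negl0. Qed.

Lemma eqv_trans g f h : eqv f g -> eqv g h -> eqv f h.
Proof.
move=> fg gh; have := neglD _ _ fg gh; rewrite /eqv.
by under eq_fun do rewrite addrA subrK.
Qed.

Lemma eqv_sym f g : eqv f g -> eqv g f.
Proof.
move=> /(neglZ (-1)); rewrite /eqv.
by under eq_fun do rewrite mulN1r opprB.
Qed.

Lemma eqvD f f' g g' : eqv f f' -> eqv g g' ->
  eqv (fun x => f x + g x) (fun x => f' x + g' x).
Proof.
move=> ff' gg'; have := neglD _ _ ff' gg'; rewrite /eqv.
by under eq_fun do rewrite addrACA -opprD.
Qed.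

Lemma eqvM f f' g g' : bnd f -> bnd g' -> eqv f f' -> eqv g g' ->
  eqv (fun x => f x * g x) (fun x => f' x * g' x).
Proof.
move=> bf bg' ff' gg'.
have := neglD _ _ (neglM _ _ bf gg') (neglM _ _ bg' ff'); rewrite /eqv.
congr negl; apply/funext => x; ring.
Qed.

Lemma eqv_sum (J : Type) (r : seq J) (f f' : J -> E -> R) :
  (forall j, eqv (f j) (f' j)) ->
  eqv (fun x => \sum_(j <- r) f j x) (fun x => \sum_(j <- r) f' j x).
Proof.
move=> ff'; have := negl_sum J r _ ff'; rewrite /eqv.
by under eq_fun do rewrite sumrB.
Qed.

(** Passes from the sum of absolute values, convenient for estimates, to the differentiable sum of
    squares. Each product [p * q] of the expanded square is bounded by [p ^+ 2 + q ^+ 2], whence the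
    factor 2. *)
Lemma size_of_sqr x : size_of x ^+ 2 <= 2 * #|I|%:R * \sum_a u a x ^+ 2.
Proof.
rewrite expr2 /size_of mulr_suml.
have -> : 2 * #|I|%:R * \sum_a u a x ^+ 2 =
    \sum_a \sum_b (u a x ^+ 2 + u b x ^+ 2).
  under [RHS]eq_bigr do rewrite big_split /= sumr_const.
  rewrite big_split /= sumrMnl sumr_const -[X in _ = X + _]mulr_natl -[X in _ = _ + X]mulr_natl.
  by rewrite -mulrA mulr2n mulrDl mul1r.
apply: ler_sum => a _; rewrite mulr_sumr; apply: ler_sum => b _.
rewrite -(real_normK (num_real (u a x))) -(real_normK (num_real (u b x))).
set p := `|u a x|; set q := `|u b x|.
have := sqr_ge0 (p - q); have := sqr_ge0 (p + q); nra.
Qed.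

(** The sum of squares [S] satisfies ['D_d S <= L * S] along the segment from [z] to [w], which
    stays in the ball and in the half-space because both are convex. *)
Lemma gronwall_family W : halfspace x0 -> open W -> W x0 ->
  (forall a, smooth_open W (u a)) ->
  (forall a i, negl ('D_(evec i) (u a))) ->
  exists2 r : R, 0 < r & forall z w, halfspace z -> halfspace w ->
    ball x0 r z -> ball x0 r w -> (forall a, u a z = 0) -> forall a, u a w = 0.
Proof.
move=> Hx0 oW Wx0 su nu.
have /choice[C HC] : forall p : I * 'I_n.+1, exists C : R,
    \forall x \near x0, halfspace x -> `|'D_(evec p.2) (u p.1) x| <= C * size_of x.
  by move=> [a i]; exact: nu.
have : \forall x \near x0, W x /\ forall p : I * 'I_n.+1,
    halfspace x -> `|'D_(evec p.2) (u p.1) x| <= C p * size_of x.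
  apply: (@filterI _ (nbhs x0)); first exact: open_nbhs_nbhs.
  exact: (@filter_forall _ _ (fun p x =>
    halfspace x -> `|'D_(evec p.2) (u p.1) x| <= C p * size_of x) (nbhs x0)).
move=> /nbhs_ballP[r /= r0 rP]; exists r => // z w Hz Hw zr wr uz.
pose d := w - z.
have ztd (t : R) : 0 <= t <= 1 -> ball x0 r (z + t *: d) /\ halfspace (z + t *: d).
  move=> /andP[t0 t1].
  have -> : z + t *: d = (1 - t) *: z + t *: w.
    by rewrite /d scalerBr scalerBl scale1r addrCA addrC.
  have t1' : 0 <= 1 - t by rewrite subr_ge0.
  split; last first.
    by move: Hz Hw; rewrite /halfspace /= !mxE => Hz Hw; rewrite addr_ge0// mulr_ge0.
  move: zr wr; rewrite -ball_normE /ball_ /= => zr wr.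
  have -> : x0 - ((1 - t) *: z + t *: w) = (1 - t) *: (x0 - z) + t *: (x0 - w).
    by apply/rowP => k; rewrite !mxE; ring.
  apply: (le_lt_trans (ler_normD _ _)); rewrite !normrZ (ger0_norm t0) (ger0_norm t1').
  have [->|t0'] := eqVneq t 0; first by rewrite mul0r addr0 subr0 mul1r.
  have tp : 0 < t by rewrite lt_neqAle eq_sym t0'.
  rewrite -[r](subrK (t * r)) -[X in X - _ + _]mul1r -mulrBl ler_ltD//.
    by rewrite ler_wpM2l// ltW.
  by rewrite ltr_pM2l.
pose S x := \sum_a u a x * u a x.
have dS x : W x -> is_derive x d S (\sum_a 2 * (u a x * 'D_d (u a) x)).
  move=> Wx; apply: is_derive_sumr => a.
  have du : derivable (u a) x d.
    exact: diff_derivable (smooth_open_differentiable W _ x oW (su a) Wx).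
  have h := derivableP du.
  by apply: (is_derive_eq (is_deriveM h h)); rewrite /GRing.scale /=; ring.
(* [K] depends on [d], hence on [z] and [w]. This is harmless: only vanishing is concluded, and [r]
   is already fixed. *)
pose K := \sum_b \sum_i `|d 0 i| * `|C (b, i)|.
have K0 : 0 <= K by apply: sumr_ge0 => b _; apply: sumr_ge0 => i _; rewrite mulr_ge0.
have dK a x : ball x0 r x -> halfspace x -> `|'D_d (u a) x| <= K * size_of x.
  move=> xr Hx; have [Wx HCx] := rP x xr.
  rewrite derive_sum_coord; last exact: (smooth_open_differentiable W).
  apply: (le_trans (ler_norm_sum _ _ _)).
  apply: (@le_trans _ _ (\sum_i `|d 0 i| * `|C (a, i)| * size_of x)).
    apply: ler_sum => i _; rewrite normrM -mulrA ler_wpM2l//.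
    apply: (le_trans (HCx (a, i) Hx)); rewrite ler_wpM2r ?size_of_ge0//.
    exact: ler_norm.
  rewrite -mulr_suml ler_wpM2r ?size_of_ge0// /K.
  rewrite (bigD1 a)//= lerDl sumr_ge0// => b _.
  by rewrite sumr_ge0// => i _; rewrite mulr_ge0.
have SE x : S x = \sum_a u a x ^+ 2 by apply: eq_bigr => a _; rewrite expr2.
pose L := 2 * K * (2 * #|I|%:R).
have dSL x : ball x0 r x -> halfspace x -> 'D_d S x <= L * S x.
  move=> xr Hx; have [Wx _] := rP x xr; have [_ ->] := dS x Wx.
  apply: (@le_trans _ _ (\sum_a 2 * K * size_of x * `|u a x|)).
    apply: ler_sum => a _; rewrite -!mulrA ler_wpM2l//.
    apply: (le_trans (ler_norm _)); rewrite normrM mulrC mulrA ler_wpM2r//.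
    exact: dK.
  rewrite -mulr_sumr -/(size_of x) -[leLHS]mulrA -expr2 /L -[leRHS]mulrA.
  by rewrite ler_wpM2l ?mulr_ge0// SE size_of_sqr.
have : S (z + d) <= 0.
  apply: (@gronwall_segment _ _ S z d L) => [t t01|t t01|].
  - have [xr Hx] := ztd t t01; have [Wx _] := rP _ xr.
    by have [] := dS _ Wx.
  - by have [xr Hx] := ztd t t01; exact: dSL.
  - by rewrite /S big1// => a _; rewrite uz mul0r.
have -> : z + d = w by rewrite /d addrC subrK.
move=> S0 a; apply/eqP; rewrite -sqrf_eq0 -(real_normK (num_real _)).
have : S w = 0 by apply/eqP; rewrite eq_le S0 SE sumr_ge0// => b _; exact: sqr_ge0.
rewrite SE => /eqP; rewrite psumr_eq0; last by move=> b _; exact: sqr_ge0.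
by move=> /allP/(_ a (mem_index_enum a)) /=; rewrite (real_normK (num_real _)).
Qed.

End Germs.

(** * The projective equation near a point *)

Lemma sum_kron (R : nzRingType) (I : finType) (i : I) (f : I -> R) :
  \sum_l (i == l)%:R * f l = f i.
Proof.
rewrite (bigD1 i)//= eqxx mul1r big1 ?addr0// => l li.
by rewrite eq_sym (negbTE li) mul0r.
Qed.

Lemma sum_kronr (R : nzRingType) (I : finType) (i : I) (f : I -> R) :
  \sum_l (l == i)%:R * f l = f i.
Proof. by under eq_bigr do rewrite eq_sym; exact: sum_kron. Qed.

(** * Product and sum rules for first-order jets modulo negligible germs *)

Section Jets.
Context {R : realType} {n : nat}.
Local Notation E := 'rV[R]_n.+1.
Variables (I : finType) (u : I -> E -> R) (x0 : E) (W : set E).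
Hypotheses (oW : open W) (Wx0 : W x0).
Implicit Types (f g a : E -> R) (x v : E).
Local Notation eqv := (eqv I u x0).
Local Notation bnd := (bnd x0).

Lemma eqv_nearl f g h : (\forall x \near x0, halfspace x -> f x = g x) -> eqv f h -> eqv g h.
Proof.
move=> fg; apply: negl_near.
by apply: (@filterS _ (nbhs x0) _ _ _ _ fg) => x fg' Hx; rewrite fg'.
Qed.

Lemma smooth_bnd f : smooth_open W f -> bnd f.
Proof. by move=> sf; apply/bnd_continuous/(smooth_open_continuous W). Qed.

Lemma smooth_bndD f m : smooth_open W f -> bnd ('D_(evec m) f).
Proof. by move=> sf; apply/smooth_bnd/smooth_open_derive. Qed.

Lemma near_W (P : set E) : (forall x, W x -> P x) -> \forall x \near x0, P x.
Proof. by move=> WP; apply: (@filterS _ (nbhs x0) _ _ _ WP); exact: open_nbhs_nbhs. Qed.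

(* The first-order jet of [f] is that of a function with value [a] and partial
   derivatives [b m], modulo negligible germs; [a] and [b] need not be related. *)
Definition jet f a (b : 'I_n.+1 -> E -> R) :=
  [/\ smooth_open W f, eqv f a, forall m, eqv ('D_(evec m) f) (b m),
      bnd a & forall m, bnd (b m)].

Lemma jet_ext f a b a' b' : a = a' -> (forall m, b m = b' m) -> jet f a b -> jet f a' b'.
Proof. by move=> <- bb [sf fa fb ba bbm]; split=> // m; rewrite -bb. Qed.

Lemma jetM f g a b a' b' : jet f a b -> jet g a' b' ->
  jet (fun x => f x * g x) (fun x => a x * a' x)
      (fun m x => a x * b' m x + b m x * a' x).
Proof.
move=> [sf fa fb ba bb] [sg ga gb ba' bb']; split.
- exact: smooth_openM.
- by apply: eqvM => //; exact: smooth_bnd.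
- move=> m; apply: (@eqv_nearl (fun x => f x * 'D_(evec m) g x + 'D_(evec m) f x * g x)).
    apply: near_W => x Wx _.
    have [df dg] := (smooth_open_derivable _ _ _ m sf Wx, smooth_open_derivable _ _ _ m sg Wx).
    by rewrite deriveM// /GRing.scale /= [_ * g x]mulrC.
  apply: eqvD; apply: eqvM => //; first exact: smooth_bnd.
  exact: smooth_bndD.
- exact: bndM.
- by move=> m; apply: bndD; apply: bndM.
Qed.

Lemma jetD f g a b a' b' : jet f a b -> jet g a' b' ->
  jet (fun x => f x + g x) (fun x => a x + a' x) (fun m x => b m x + b' m x).
Proof.
move=> [sf fa fb ba bb] [sg ga gb ba' bb']; split.
- exact: smooth_openD.
- exact: eqvD.
- move=> m; apply: (@eqv_nearl (fun x => 'D_(evec m) f x + 'D_(evec m) g x)).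
    apply: near_W => x Wx _.
    by rewrite deriveD//; exact: smooth_open_derivable Wx.
  exact: eqvD.
- exact: bndD.
- by move=> m; apply: bndD.
Qed.

Lemma jet_self f : smooth_open W f -> jet f f (fun m => 'D_(evec m) f).
Proof.
move=> sf; split=> //; try exact: eqv_refl.
- by move=> m; exact: eqv_refl.
- exact: smooth_bnd.
- by move=> m; exact: smooth_bndD.
Qed.

Lemma jet_cst (c : R) : jet (fun=> c) (fun=> c) (fun _ _ => 0).
Proof.
apply: jet_ext (jet_self _ (smooth_open_cst W c)) => // m.
by apply/funext => x; exact: derive_cst.
Qed.

Lemma jet_sum (J : Type) (r : seq J) (f a : J -> E -> R) (b : J -> 'I_n.+1 -> E -> R) :
  (forall j, jet (f j) (a j) (b j)) ->
  jet (fun x => \sum_(j <- r) f j x) (fun x => \sum_(j <- r) a j x)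
      (fun m x => \sum_(j <- r) b j m x).
Proof.
move=> H; elim: r => [|j r IH].
  under eq_fun do rewrite big_nil.
  apply: jet_ext (jet_cst 0) => [|m]; by apply/funext => x; rewrite big_nil.
under eq_fun do rewrite big_cons.
apply: jet_ext (jetD _ _ _ _ _ _ (H j) IH) => [|m]; by apply/funext => x; rewrite big_cons.
Qed.

End Jets.

(** * Prolongation of the projective equation *)

Section LocalRigidity.
Context {R : realType} {n : nat}.
Local Notation E := 'rV[R]_n.+1.

Definition dcomp (F : E -> E) i j : E -> R := 'D_(evec j) (fun y => F y 0 i).

(* The value the projective equation assigns to d_j d_k F^i. *)
Definition proj_rhs (F : E -> E) (G : 'I_n.+1 -> 'I_n.+1 -> 'I_n.+1 -> E -> R)
    (U : 'I_n.+1 -> E -> R) i j k x :=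
  \sum_l dcomp F i l x * G l j k x + dcomp F i j x * U k x + dcomp F i k x * U j x
  - \sum_l \sum_m G i l m (F x) * (dcomp F l j x * dcomp F m k x).

Lemma lipschitz_near (V : set E) (g : E -> R) x0 : open V -> V x0 -> smooth_open V g ->
  exists C, exists2 r : R, 0 < r & forall x y, ball x0 r x -> ball x0 r y ->
    `|g y - g x| <= C * `|y - x|.
Proof.
move=> oV Vx0 sg.
pose P (i : 'I_n.+1) x := `|'D_(evec i) g x0 - 'D_(evec i) g x| <= 1.
have nP i : \forall x \near x0, P i x.
  have c := smooth_open_continuous V _ _ (smooth_open_derive _ _ i sg) Vx0.
  by have /(@cvgrPdist_le _ _ _ (nbhs x0)) cx := c; exact: (cx 1).
have : \forall x \near x0, V x /\ forall i, P i x.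
  apply: (@filterI _ (nbhs x0)); first exact: open_nbhs_nbhs.
  exact: (@filter_forall _ _ P (nbhs x0)).
move=> /nbhs_ballP[r /= r0 rP].
pose C := \sum_i (`|'D_(evec i) g x0| + 1).
have C0 : 0 <= C by apply: sumr_ge0 => i _; rewrite addr_ge0.
have r30 : 0 < r / 3 by rewrite divr_gt0.
(* [MVT_line] may return a negative [s], so the intermediate point is only known to lie within
   [|x0 - x| + |y - x| < r / 3 + 2 * r / 3] of [x0]. On that ball each partial derivative is within
   1 of its value at [x0], which gives [C]. *)
exists C, (r / 3) => // x y; rewrite -ball_normE /ball_ /= => xr yr.
have seg (s : R) : `|s| <= `|1 : R| -> ball x0 r (x + s *: (y - x)).
  rewrite normr1 => s1; rewrite -ball_normE /ball_ /= opprD addrA.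
  apply: (le_lt_trans (ler_normB _ _)); rewrite normrZ.
  have yx : `|y - x| < r / 3 + r / 3.
    rewrite -(subrKA x0); apply: (le_lt_trans (ler_normD _ _)).
    by rewrite ltrD// distrC.
  have sy : `|s| * `|y - x| <= `|y - x| by rewrite ler_piMl.
  have : `|x0 - x| + `|s| * `|y - x| < r / 3 + (r / 3 + r / 3).
    by rewrite ltr_leD// (le_trans sy)// ltW.
  by move=> /lt_le_trans; apply; rewrite le_eqVlt; apply/orP; left; apply/eqP; field.
have [s /seg sr|s /seg sr] := @MVT_line R n g x (y - x) 1.
  by apply: diff_derivable; apply: (smooth_open_differentiable V) => //; exact: (rP _ sr).1.
have [Vs Ps] := rP _ sr.
rewrite scale1r [x + _]addrC subrK mul1r => ->.
rewrite derive_sum_coord; last exact: (smooth_open_differentiable V).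
apply: (le_trans (ler_norm_sum _ _ _)); rewrite /C mulr_suml.
apply: ler_sum => i _; rewrite normrM mulrC ler_pM//; last exact: entry_le_norm.
rewrite -[leLHS]/(`|'D_(evec i) g (x + s *: (y - x))|).
rewrite -lerBlDl; apply: le_trans (Ps i); rewrite distrC.
exact: lerB_dist.
Qed.

Variables (x0 : E) (F : E -> E) (G : 'I_n.+1 -> 'I_n.+1 -> 'I_n.+1 -> E -> R).
Variables (U : 'I_n.+1 -> E -> R) (W V : set E).
Hypotheses (n0 : (0 < n)%N) (Hx0 : halfspace x0) (Fx0 : F x0 = x0).
Hypotheses (oW : open W) (Wx0 : W x0) (oV : open V) (Vx0 : V x0).
Hypotheses (sF : forall i, smooth_open W (fun y => F y 0 i)).
Hypotheses (sG : forall i j k, smooth_open V (G i j k)).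
Hypotheses (sU : forall k, smooth_open W (U k)).
Hypothesis (EQ : \forall x \near x0, halfspace x ->
  forall i j k, 'D_(evec j) (dcomp F i k) x = proj_rhs F G U i j k x).

Let I : finType := ('I_n.+1 + 'I_n.+1 * 'I_n.+1 + 'I_n.+1)%type.

Let u (a : I) : E -> R := match a with
  | inl (inl i) => fun x => F x 0 i - x 0 i
  | inl (inr (i, j)) => fun x => dcomp F i j x - (i == j)%:R
  | inr k => U k end.

Local Notation eqv := (eqv I u x0).
Local Notation negl := (negl I u x0).
Local Notation bnd := (bnd x0).

Let sDF i j : smooth_open W (dcomp F i j).
Proof. exact/smooth_open_derive/sF. Qed.

Let su a : smooth_open W (u a).
Proof.
have sub f g : smooth_open W f -> smooth_open W g -> smooth_open W (fun x => f x - g x).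
  move=> sf sg; have := smooth_openD W f _ oW sf
    (smooth_openM W _ _ oW (smooth_open_cst W (-1)) sg).
  by under eq_fun do rewrite mulN1r.
case: a => [[i|[i j]]|k] /=; last exact: sU.
  by apply: sub => //; exact: smooth_open_coord.
by apply: sub => //; exact: smooth_open_cst.
Qed.

Let eDF i j : eqv (dcomp F i j) (fun=> (i == j)%:R).
Proof. exact: (negl_u I u x0 (inl (inr (i, j)))). Qed.

Let eU k : eqv (U k) (fun=> 0).
Proof.
have := negl_u I u x0 (inr k); rewrite /eqv.
by under [X in _ -> negl X]eq_fun do rewrite subr0.
Qed.

(** Both [G] and [G \o F] occur in the argument, so a point and its image must lie in [V]. *)
Let W' := (W `&` F @^-1` V) `&` V.

Let cF x : W x -> continuous_at x F.
Proof. by move=> Wx; apply: continuous_row => l; exact: smooth_open_continuous (sF l) Wx. Qed.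

Let oW' : open W'.
Proof.
apply: openI => //; rewrite openE => y [Wy W'y].
apply: (@filterI _ (nbhs y)); first exact: open_nbhs_nbhs.
by apply: (cF y Wy); exact: open_nbhs_nbhs.
Qed.

Let W'x0 : W' x0. Proof. by split=> //; split=> //=; rewrite Fx0. Qed.

Let W'W : W' `<=` W. Proof. by move=> x [[]]. Qed.

Let W'V : W' `<=` V. Proof. exact: subIsetr. Qed.

(** The entries of [F x - x] belong to the family [u], so a Lipschitz bound makes the change of
    argument negligible. *)
Let ecomp g : smooth_open V g -> eqv (g \o F) g.
Proof.
move=> sg; have [C [r r0 Cr]] := lipschitz_near V g x0 oV Vx0 sg.
have nr : \forall x \near x0, ball x0 r (F x).
  by have := cF x0 Wx0; apply; rewrite Fx0; exact: nbhsx_ballx.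
have nn : \forall x \near x0, ball x0 r x /\ ball x0 r (F x).
  by apply: (@filterI _ (nbhs x0)) => //; exact: nbhsx_ballx.
exists `|C|; apply: (@filterS _ (nbhs x0) _ _ _ _ nn) => x [xr Fxr] _.
apply: (le_trans (Cr x (F x) xr Fxr)).
apply: (@le_trans _ _ (`|C| * `|F x - x|)); first by rewrite ler_wpM2r// ler_norm.
rewrite ler_wpM2l//; apply: norm_le_entries => [|i]; first exact: size_of_ge0.
rewrite !mxE /size_of (bigD1 (inl (inl i)))//= lerDl.
exact: sumr_ge0.
Qed.

Let bDF i j : bnd (dcomp F i j). Proof. exact: smooth_bnd (sDF i j). Qed.

Let bU k : bnd (U k). Proof. exact: smooth_bnd (sU k). Qed.

Let bG i j k : bnd (G i j k). Proof. exact: smooth_bnd (sG i j k). Qed.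

Let scomp g : smooth_open V g -> smooth_open W' (g \o F).
Proof.
move=> sg; apply: (@smooth_open_comp _ _ _ V) => // [x [[]]//|l].
exact: smooth_open_sub (sF l).
Qed.

(** Replacing [dcomp F] by the Kronecker symbol, [U] by 0 and [F] by the identity costs negligible
    terms, and then the two Christoffel terms cancel. [rhs0] is the zero function written in the
    shape of [proj_rhs], so that the replacement goes term by term. *)
Let negl_D2F i j k : negl ('D_(evec j) (dcomp F i k)).
Proof.
apply: (@negl_near _ _ _ _ _ (proj_rhs F G U i j k)).
  by apply: (@filterS _ (nbhs x0) _ _ _ _ EQ) => x H Hx; rewrite H.
have : eqv (proj_rhs F G U i j k) (fun=> 0); last first.
  by rewrite /eqv; under eq_fun do rewrite subr0.
pose rhs0 x := \sum_l (i == l)%:R * G l j k x + (i == j)%:R * 0 + (i == k)%:R * 0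
   + (-1) * \sum_l \sum_m G i l m x * ((l == j)%:R * (m == k)%:R).
have -> : (fun=> 0) = rhs0.
  apply/funext => x; rewrite /rhs0 sum_kron !mulr0 !addr0 mulN1r.
  under eq_bigr do under eq_bigr do rewrite mulrA mulrC.
  under eq_bigr do rewrite sum_kronr mulrC.
  by rewrite sum_kronr subrr.
have -> : proj_rhs F G U i j k = fun x =>
    \sum_l dcomp F i l x * G l j k x + dcomp F i j x * U k x + dcomp F i k x * U j x
  + (-1) * \sum_l \sum_m (G i l m \o F) x * (dcomp F l j x * dcomp F m k x).
  by apply/funext => x; rewrite mulN1r.
apply: eqvD; [apply: eqvD; [apply: eqvD|]|].
- apply: eqv_sum => l; apply: eqvM => //; exact: eqv_refl.
- by apply: eqvM => //; exact: bnd_cst.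
- by apply: eqvM => //; exact: bnd_cst.
apply: eqvM; [exact: bnd_cst| |exact: eqv_refl|].
  apply: bnd_sum => l; apply: bnd_sum => m; apply: bndM => //.
  by apply: bndM; exact: bnd_cst.
apply: eqv_sum => l; apply: eqv_sum => m; apply: eqvM => //.
- exact: smooth_bnd (scomp _ (sG i l m)).
- by apply: bndM; exact: bnd_cst.
- exact: ecomp.
- by apply: eqvM => //; exact: bnd_cst.
Qed.

Local Notation jet := (jet I u x0 W').

Let jDF i l : jet (dcomp F i l) (fun=> (i == l)%:R) (fun _ _ => 0).
Proof.
split=> //; [exact: smooth_open_sub (sDF i l)| |exact: bnd_cst|by move=> _; exact: bnd_cst].
by move=> m; have := negl_D2F i m l; rewrite /eqv; under [X in _ -> negl X]eq_fun do rewrite subr0.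
Qed.

(** The value is dropped but the derivatives are kept: they are the unknowns that [negl_dU]
    eliminates. *)
Let jU k : jet (U k) (fun=> 0) (fun m => 'D_(evec m) (U k)).
Proof.
split=> //; [exact: smooth_open_sub (sU k)| |exact: bnd_cst|].
  by move=> m; exact: eqv_refl.
by move=> m; exact: smooth_bndD (sU k).
Qed.

Let sGW i j k : smooth_open W' (G i j k).
Proof. exact: smooth_open_sub (sG i j k). Qed.

Let jG i j k : jet (G i j k) (G i j k) (fun m => 'D_(evec m) (G i j k)).
Proof. exact: (jet_self I u x0 W' W'x0). Qed.

Let jGF i j k : jet (G i j k \o F) (G i j k) (fun m => 'D_(evec m) (G i j k)).
Proof.
split=> //.
- exact: scomp.
- exact: ecomp.
- move=> m; have -> : 'D_(evec m) (G i j k) =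
      fun x => \sum_p 'D_(evec p) (G i j k) x * (p == m)%:R.
    by apply/funext => x; under eq_bigr do rewrite mulrC; rewrite sum_kronr.
  apply: (@eqv_nearl _ _ _ u x0 (fun x => \sum_p ('D_(evec p) (G i j k) \o F) x * dcomp F p m x)).
    apply: (near_W x0 W' oW' W'x0) => x [[Wx VFx] Vx] _.
    rewrite derive_comp// => [l|]; first exact: (smooth_open_differentiable W).
    exact: (smooth_open_differentiable V).
  apply: eqv_sum => p; apply: eqvM; [|exact: bnd_cst| |exact: eDF].
    exact/(smooth_bnd _ _ W'x0)/scomp/smooth_open_derive.
  exact/ecomp/smooth_open_derive.
- by move=> m; exact: smooth_bndD (sGW i j k).
Qed.

Local Notation jM := (jetM I u x0 W' oW' W'x0 _ _ _ _ _ _).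
Local Notation jD := (jetD I u x0 W' oW' W'x0 _ _ _ _ _ _).
Local Notation jS := (jet_sum I u x0 W' oW' W'x0 _ _ _ _ _).

(** Product rule on jets: derivatives of [dcomp] drop out by [negl_D2F], the derivatives of the two
    Christoffel terms cancel, and only those of [U] survive. *)
Let negl_dRHS i j k m : eqv ('D_(evec m) (proj_rhs F G U i j k))
  (fun x => (i == j)%:R * 'D_(evec m) (U k) x + (i == k)%:R * 'D_(evec m) (U j) x).
Proof.
have J1 : jet (fun x => \sum_l dcomp F i l x * G l j k x) (G i j k)
    (fun m => 'D_(evec m) (G i j k)).
  apply: jet_ext (jS
    (fun l => jM (jDF i l) (jG l j k))).
  - by apply/funext => x; rewrite sum_kron.
  - move=> p; apply/funext => x.
    by under eq_bigr do rewrite mul0r addr0; rewrite sum_kron.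
have J2 j' k' : jet (fun x => dcomp F i j' x * U k' x) (fun=> 0)
    (fun m x => (i == j')%:R * 'D_(evec m) (U k') x).
  apply: jet_ext (jM (jDF i j') (jU k')).
  - by apply/funext => x; rewrite mulr0.
  - by move=> p; apply/funext => x; rewrite mul0r addr0.
have J3 : jet (fun x => \sum_l \sum_m (G i l m \o F) x * (dcomp F l j x * dcomp F m k x))
   (G i j k) (fun m => 'D_(evec m) (G i j k)).
  apply: jet_ext (jS (fun l =>
    jS (fun m => jM (jGF i l m)
      (jM (jDF l j) (jDF m k))))).
  - apply/funext => x; under eq_bigr do under eq_bigr do rewrite mulrA mulrC.
    by under eq_bigr do rewrite sum_kronr mulrC; rewrite sum_kronr.
  - move=> p; apply/funext => x.
    under eq_bigr do under eq_bigr do rewrite mulr0 mul0r addr0 mulr0 add0r mulrA mulrC.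
    by under eq_bigr do rewrite sum_kronr mulrC; rewrite sum_kronr.
have J4 := jM (jet_cst I u x0 W' W'x0 (-1)) J3.
have J := jD
  (jD (jD J1 (J2 j k)) (J2 k j)) J4.
have -> : proj_rhs F G U i j k = fun x =>
    \sum_l dcomp F i l x * G l j k x + dcomp F i j x * U k x + dcomp F i k x * U j x
  + (-1) * \sum_l \sum_m (G i l m \o F) x * (dcomp F l j x * dcomp F m k x).
  by apply/funext => x; rewrite mulN1r.
have [_ _ /(_ m) + _ _] := J; congr (eqv _ _); apply/funext => x.
by rewrite mul0r addr0 mulN1r addrC !addrA addNr add0r.
Qed.

Let smooth_rhs i j k : smooth_open W' (proj_rhs F G U i j k).
Proof.
have sD f g := smooth_openD W' f g oW'.
have sM f g := smooth_openM W' f g oW'.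
have sS (f : 'I_n.+1 -> E -> R) : (forall l, smooth_open W' (f l)) ->
    smooth_open W' (fun x => \sum_l f l x).
  by move=> sf p; apply: Ck_sum => // l; exact: sf.
have sD' p q : smooth_open W' (dcomp F p q) by exact: smooth_open_sub (sDF p q).
have sU' p : smooth_open W' (U p) by exact: smooth_open_sub (sU p).
have -> : proj_rhs F G U i j k = fun x =>
    \sum_l dcomp F i l x * G l j k x + dcomp F i j x * U k x + dcomp F i k x * U j x
  + (-1) * \sum_l \sum_m (G i l m \o F) x * (dcomp F l j x * dcomp F m k x).
  by apply/funext => x; rewrite mulN1r.
apply: (sD _ _); [apply: (sD _ _); [apply: (sD _ _)|]|]; try exact: sM.
  by apply: (sS _) => l; exact: sM.
apply: (sM _ _); first exact: smooth_open_cst.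
apply: (sS _) => l; apply: (sS _) => m; apply: (sM _ _); first exact: scomp.
exact: sM.
Qed.

(** [EQ] is an identity on the half-space only. Its two sides still have the same partial
    derivatives at points of the half-space, because both are equal to the one-sided [hpartial]. *)
Let negl_D3F i j k m : eqv ('D_(evec m) ('D_(evec j) (dcomp F i k)))
  (fun x => (i == j)%:R * 'D_(evec m) (U k) x + (i == k)%:R * 'D_(evec m) (U j) x).
Proof.
apply: (@eqv_nearl _ _ _ u x0 ('D_(evec m) (proj_rhs F G U i j k))); last exact: negl_dRHS.
have nEQ : \forall x \near x0, \forall y \near x, halfspace y ->
    'D_(evec j) (dcomp F i k) y = proj_rhs F G U i j k y.
  by apply: near_join; apply: (@filterS _ (nbhs x0) _ _ _ _ EQ) => x H Hx; exact: H.
have nW : \forall x \near x0, W' x by exact: open_nbhs_nbhs.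
apply: (@filterS2 _ (nbhs x0) _ _ _ _ _ nEQ nW) => x EQx W'x Hx.
rewrite -(hpartial_ext m ('D_(evec j) (dcomp F i k)) ('D_(evec j) (dcomp F i k)) x Hx).
- apply: esym; apply: hpartial_ext => //.
  exact: smooth_open_derivable (smooth_rhs i j k) W'x.
- by apply: (smooth_open_derivable W); [exact/smooth_open_derive/sDF|exact: W'W].
- exact: (@nearW _ (nbhs x)).
Qed.

Lemma negl_dU k m : negl ('D_(evec m) (U k)).
Proof.
(* Exact symmetry of the third derivatives of [F i] in [p] and [q], read on their leading terms. *)
have sym i p q s : eqv
    (fun x => (i == p)%:R * 'D_(evec q) (U s) x + (i == s)%:R * 'D_(evec q) (U p) x)
    (fun x => (i == q)%:R * 'D_(evec p) (U s) x + (i == s)%:R * 'D_(evec p) (U q) x).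
  apply: eqv_trans (eqv_sym _ _ _ _ _ (negl_D3F i p s q)) _.
  apply: eqv_nearl (negl_D3F i q s p).
  apply: (near_W x0 W' oW' W'x0) => x W'x _.
  exact: derive_sym oW (sDF i s) (W'W _ W'x).
have to0 f : eqv f (fun=> 0) -> negl f.
  by rewrite /eqv; under eq_fun do rewrite subr0.
(* For k = m take i = j <> k in [sym]; for k <> m take i = j = k, so that
   2 d_m U_k = d_k U_m and 2 d_k U_m = d_m U_k. *)
have [<-{m}|km] := eqVneq k m.
  (* A second index exists because [0 < n], i.e. the dimension is at least 2. *)
  have [i ik] : exists i, i != k.
    have [->|k0] := eqVneq k ord0; last by exists ord0; rewrite eq_sym.
    by exists ord_max; rewrite -val_eqE /= -lt0n.
  apply: to0; have := sym i i k k.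
  rewrite eqxx (negbTE ik); congr (eqv _ _); apply/funext => x.
    by rewrite mul1r mul0r addr0.
  by rewrite !mul0r addr0.
have rel p q : p != q -> negl (fun x => 2 * 'D_(evec q) (U p) x - 'D_(evec p) (U q) x).
  move=> pq; have := sym p p q p; rewrite eqxx (negbTE pq) /eqv; congr negl.
  by apply/funext => x; rewrite !mul1r mul0r add0r mulr_natl mulr2n.
have mk : m != k by rewrite eq_sym.
(* With a = d_m U_k and b = d_k U_m, 2/3 (2 a - b) + 1/3 (2 b - a) = a. *)
have := neglD _ _ _ _ _ (neglZ _ _ _ (2 / 3) _ (rel k m km)) (neglZ _ _ _ (1 / 3) _ (rel m k mk)).
congr negl; apply/funext => x.
by move: ('D_(evec m) (U k) x) ('D_(evec k) (U m) x) => a b; lra.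
Qed.

(** The family [u] is closed under differentiation modulo its own size: derivatives of [F - id] are
    again members of [u], those of [dcomp F] and [U] are negligible. At [x0] itself only [F x0 = x0]
    is assumed; the full zero of [u] is required at [z]. *)
Theorem local_rigidity : exists2 r : R, 0 < r &
  forall z w, halfspace z -> halfspace w -> ball x0 r z -> ball x0 r w ->
    F z = z -> (forall i j, dcomp F i j z = (i == j)%:R) -> (forall k, U k z = 0) -> F w = w.
Proof.
have [|r r0 H] := gronwall_family I u x0 W Hx0 oW Wx0 su.
  move=> a i; case: a => [[l|[l p]]|k] /=; last exact: negl_dU.
    have := negl_u I u x0 (inl (inr (l, i))); apply: negl_near.
    apply: (near_W x0 W oW Wx0) => x Wx _ /=.
    rewrite (@deriveB _ _ _ (fun x => F x 0 l) (fun x => x 0 l)).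
    - by have [_ ->] := is_derive_coord l (evec i) x; rewrite mxE eqxx.
    - exact: smooth_open_derivable (sF l) Wx.
    - by have [] := is_derive_coord l (evec i) x.
  apply: negl_near (negl_D2F l i p).
  apply: (near_W x0 W oW Wx0) => x Wx _ /=.
  rewrite (@deriveB _ _ _ (dcomp F l p) (fun=> (l == p)%:R)).
  - by rewrite derive_cst subr0.
  - exact: smooth_open_derivable (sDF l p) Wx.
  - exact: derivable_cst.
exists r => // z w Hz Hw zr wr Fz DFz Uz.
have u0 : forall a, u a z = 0.
  by move=> [[i|[i j]]|k] /=; rewrite ?Fz ?DFz ?Uz ?subrr.
have uw := H z w Hz Hw zr wr u0.
by apply/rowP => i; have /eqP := uw (inl (inl i)); rewrite /= subr_eq0 => /eqP.
Qed.

End LocalRigidity.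

(** * The projective equation at the boundary *)

Section BoundaryAlgebra.
Context {R : realFieldType} {n : nat}.
Local Notation I := 'I_n.+1.
Variables (d : I -> I -> R) (G : I -> I -> I -> R) (U : I -> R).

Let rhs i j k := \sum_l d i l * G l j k + d i j * U k + d i k * U j
  - \sum_l \sum_m G i l m * (d l j * d m k).

Hypothesis d_tan : forall i l, l != ord0 -> d i l = (i == l)%:R.

(** The deviation of the normal column from that of the identity, the only unknown part of the
    Jacobian. *)
Let b i := d i ord0 - (i == ord0)%:R.

Let dE i l : d i l = (i == l)%:R + (l == ord0)%:R * b i.
Proof.
have [->|l0] := eqVneq l ord0; first by rewrite mul1r /b addrC subrK.
by rewrite mul0r addr0 d_tan.
Qed.

Let sum_d i (f : I -> R) : \sum_l d i l * f l = f i + b i * f ord0.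
Proof.
under eq_bigr do rewrite dE mulrDl -mulrA.
by rewrite big_split /= sum_kron sum_kronr.
Qed.

Let sum_dr (f : I -> R) k : k != ord0 -> \sum_m f m * d m k = f k.
Proof.
by move=> k0; under eq_bigr do rewrite mulrC d_tan//; rewrite sum_kronr.
Qed.

Let sum_dr0 (f : I -> R) : \sum_m f m * d m ord0 = f ord0 + \sum_m b m * f m.
Proof.
under eq_bigr do rewrite mulrC dE eqxx mul1r mulrDl.
by rewrite big_split /= sum_kronr.
Qed.

(** Tangential columns of [d] are Kronecker, so the quadratic term is [G i j k]; the linear one is
    the same plus a correction from the normal column. *)
Lemma rhs_tan i j k : j != ord0 -> k != ord0 ->
  rhs i j k = b i * G ord0 j k + (i == j)%:R * U k + (i == k)%:R * U j.
Proof.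
move=> j0 k0; rewrite /rhs sum_d !d_tan//.
under [X in _ - X]eq_bigr do under eq_bigr do rewrite mulrA.
under [X in _ - X]eq_bigr do rewrite (sum_dr (fun m => G i _ m * d _ j))//.
by rewrite sum_dr//; ring.
Qed.

(** Here the quadratic term carries the correction, through the normal column [d l ord0]; the linear
    term has none because [b ord0 = 0]. *)
Lemma rhs_normal k : d ord0 ord0 = 1 -> k != ord0 ->
  rhs ord0 ord0 k = U k - \sum_l b l * G ord0 l k.
Proof.
move=> d0 k0; have b0 : b ord0 = 0 by rewrite /b d0 eqxx subrr.
rewrite /rhs sum_d b0 d0 (d_tan ord0)// (eq_sym ord0) (negbTE k0).
under [X in _ - X]eq_bigr do under eq_bigr do rewrite mulrA.
under [X in _ - X]eq_bigr do rewrite (sum_dr (fun m => G ord0 _ m * d _ ord0))//.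
by rewrite sum_dr0 mulr0n; ring.
Qed.

Variables nu mu : I.
Hypotheses (nu0 : nu != ord0) (mu0 : mu != ord0) (G0 : G ord0 nu mu != 0).
Hypothesis rhs0 : forall i j k, j != ord0 -> k != ord0 -> rhs i j k = 0.

(** For [i = ord0] both Kronecker terms of [rhs_tan] vanish and leave
    [b ord0 * G ord0 nu mu = 0]. *)
Lemma normal_derivative1 : d ord0 ord0 = 1.
Proof.
have := rhs0 ord0 nu mu nu0 mu0; rewrite rhs_tan//.
rewrite 2!(eq_sym ord0) (negbTE nu0) (negbTE mu0) !mul0r !addr0 => /eqP.
by rewrite mulf_eq0 (negbTE G0) orbF /b eqxx subr_eq0 => /eqP.
Qed.

Hypothesis rhs1 : forall k, k != ord0 -> rhs ord0 ord0 k = 0.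

(* Summing [rhs l l k = 0] over tangential l and inserting [rhs1] gives a
   positive multiple of [U k]. *)
Lemma tangential_Upsilon0 k : k != ord0 -> U k = 0.
Proof.
move=> k0; have := rhs1 k k0; rewrite rhs_normal//; last exact: normal_derivative1.
have b0 : b ord0 = 0 by rewrite /b normal_derivative1 eqxx subrr.
rewrite (bigD1 ord0)//= b0 mul0r add0r => /eqP; rewrite subr_eq0 => /eqP Uk.
have : \sum_(l | l != ord0) (b l * G ord0 l k + U k + (l == k)%:R * U l) = 0.
  apply: big1 => l l0; have := rhs0 l l k l0 k0.
  by rewrite rhs_tan// eqxx mul1r.
rewrite !big_split /= -Uk sumr_const.
have -> : \sum_(l | l != ord0) (l == k)%:R * U l = U k.
  rewrite -[RHS](sum_kronr _ _ k U) [RHS](bigD1 ord0)//= (eq_sym ord0) (negbTE k0).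
  by rewrite mul0r add0r.
(* [U k] occurs once through [Uk], once for each of the [n] tangential indices, and once from the
   Kronecker sum: [n + 2] times in all. *)
rewrite -mulrS -mulrSr => /eqP; rewrite mulrn_eq0 /= => /eqP.
exact.
Qed.

(** Once the tangential [U] vanish, [rhs_tan] at [nu], [mu] is [b i * G ord0 nu mu] for every [i],
    not only for [ord0]. *)
Lemma boundary_jacobian i j : d i j = (i == j)%:R.
Proof.
have [->|j0] := eqVneq j ord0; last exact: d_tan.
have := rhs0 i nu mu nu0 mu0; rewrite rhs_tan// !tangential_Upsilon0//.
rewrite !mulr0 !addr0 => /eqP; rewrite mulf_eq0 (negbTE G0) orbF /b subr_eq0.
by move=> /eqP.
Qed.

Hypothesis rhs2 : rhs nu nu ord0 = 0.

(** With [d] the identity the Christoffel terms cancel, and [rhs nu nu ord0] is exactly [U ord0]. *)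
Lemma normal_Upsilon0 : U ord0 = 0.
Proof.
move: rhs2; rewrite /rhs.
under eq_bigr do rewrite boundary_jacobian.
under [X in _ - X]eq_bigr do under eq_bigr do rewrite !boundary_jacobian mulrA mulrC.
under [X in _ - X]eq_bigr do rewrite sum_kronr mulrC.
rewrite sum_kron sum_kronr !boundary_jacobian eqxx (negbTE nu0) mul1r mul0r addr0.
by rewrite addrC addrA addNr add0r.
Qed.

End BoundaryAlgebra.

(** * Tangential differentiation of the boundary identities *)

Section BoundaryJet.
Context {R : realType} {n : nat}.
Local Notation E := 'rV[R]_n.+1.

(** For a tangential [i] the line through [x] stays in the boundary, so the difference quotients of
    [f] and [g] coincide. *)
Lemma derive_boundary (f g : E -> R) (x : E) i : i != ord0 -> x 0 ord0 = 0 ->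
  (\forall y \near x, (y : E) 0 ord0 = 0 -> f y = g y) ->
  'D_(evec i) f x = 'D_(evec i) g x.
Proof.
move=> i0 x0 fg; rewrite /derive; congr (lim _).
have bd (h : R) : (h *: evec i + x) 0 ord0 = 0.
  by rewrite !mxE eqxx /= eq_sym (negbTE i0) mulr0 add0r.
have fgx : f x = g x by exact: (nbhs_singleton fg).
have c : (fun h : R => h *: evec i + x) @ (0 : R) --> x.
  rewrite -[X in _ --> X]add0r; apply: (@cvgD _ _ _ (nbhs (0 : R))); last exact: cvg_cst.
  by rewrite -[X in _ --> X](scale0r (evec i : E)); exact: scalel_continuous.
have nfg : \forall h \near (0 : R)^', f (h *: evec i + x) = g (h *: evec i + x).
  apply: cvg_within; have := c _ fg.
  by apply: (@filterS _ (nbhs (0 : R))) => h; apply; exact: bd.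
rewrite eqEsubset; split; apply: (@near_eq_cvg _ _ ((0 : R)^'));
  by apply: filterS nfg => h /= fgh; rewrite fgh fgx.
Qed.

Variables (x0 : E) (F : E -> E) (G : 'I_n.+1 -> 'I_n.+1 -> 'I_n.+1 -> E -> R).
Variables (U : 'I_n.+1 -> E -> R) (W : set E) (nu mu : 'I_n.+1).
Hypotheses (bx0 : x0 0 ord0 = 0) (oW : open W) (Wx0 : W x0).
Hypothesis sF : forall i, smooth_open W (fun y => F y 0 i).
Hypotheses (nu0 : nu != ord0) (mu0 : mu != ord0).
Hypothesis H : \forall x \near x0, (x : E) 0 ord0 = 0 ->
  [/\ F x = x, G ord0 nu mu x != 0 &
      forall i j k, 'D_(evec j) (dcomp F i k) x = proj_rhs F G U i j k x].

(** What the algebra at a single boundary point takes as input; [F x = x] has been used in the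
    argument of [G]. *)
Let alg (x : E) := [/\ x 0 ord0 = 0,
  forall i l, l != ord0 -> dcomp F i l x = (i == l)%:R, G ord0 nu mu x != 0 &
  forall i j k, 'D_(evec j) (dcomp F i k) x =
    \sum_l dcomp F i l x * G l j k x + dcomp F i j x * U k x + dcomp F i k x * U j x
    - \sum_l \sum_m G i l m x * (dcomp F l j x * dcomp F m k x)].

(** This fact and the next three hold near [x0] and not just at [x0]: [near_join] makes each of them
    available around every nearby boundary point, where it can be differentiated along the
    boundary. *)
Let near_alg : \forall x \near x0, (x : E) 0 ord0 = 0 -> alg x.
Proof.
apply: (@filterS _ (nbhs x0) _ _ _ _ (near_join H)) => x Hx bx.
have [Fx Gx EQx] := nbhs_singleton Hx bx.
split=> // [i l l0|i j k]; last by rewrite EQx /proj_rhs Fx.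
rewrite /dcomp (@derive_boundary _ (fun y : E => y 0 i))//.
  by have [_ ->] := is_derive_coord i (evec l) x; rewrite mxE eqxx.
by apply: (@filterS _ (nbhs x) _ _ _ _ Hx) => y Hy /Hy[-> _ _].
Qed.

Let near_alg1 : \forall x \near x0, (x : E) 0 ord0 = 0 ->
  alg x /\ forall i j k, j != ord0 -> k != ord0 -> 'D_(evec j) (dcomp F i k) x = 0.
Proof.
apply: (@filterS _ (nbhs x0) _ _ _ _ (near_join near_alg)) => x Hx bx.
have ax := nbhs_singleton Hx bx; split=> // i j k j0 k0.
rewrite (@derive_boundary _ (fun=> (i == k)%:R))//; first exact: derive_cst.
by apply: (@filterS _ (nbhs x) _ _ _ _ Hx) => y Hy /Hy[_ -> //].
Qed.

Let near_alg2 : \forall x \near x0, (x : E) 0 ord0 = 0 ->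
  [/\ alg x, (forall i j k, j != ord0 -> k != ord0 -> 'D_(evec j) (dcomp F i k) x = 0) &
      forall k, k != ord0 -> 'D_(evec ord0) (dcomp F ord0 k) x = 0].
Proof.
have nW : \forall x \near x0, W x by exact: open_nbhs_nbhs.
apply: (@filterS2 _ (nbhs x0) _ _ _ _ _ (near_join near_alg1) nW) => x Hx Wx bx.
have [ax ax1] := nbhs_singleton Hx bx; split=> // k k0.
(* After the exchange, [dcomp F ord0 ord0] is differentiated in a tangential direction, and by
   [normal_derivative1] it is constantly 1 along the boundary. *)
rewrite /dcomp (derive_sym W)//.
rewrite (@derive_boundary _ (fun=> 1))//; first exact: derive_cst.
apply: (@filterS _ (nbhs x) _ _ _ _ Hx) => y Hy /Hy[[_ d_tan Gy EQy] ay1].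
apply: (normal_derivative1 (fun i l => dcomp F i l y) (fun i j k => G i j k y)
  (fun k => U k y) d_tan nu mu nu0 mu0 Gy) => i j l j0 l0.
by rewrite -EQy ay1.
Qed.

Let near_jacobian : \forall x \near x0, (x : E) 0 ord0 = 0 ->
  [/\ alg x, (forall i j, dcomp F i j x = (i == j)%:R) &
      forall k, k != ord0 -> U k x = 0].
Proof.
apply: (@filterS _ (nbhs x0) _ _ _ _ near_alg2) => y Hy /Hy[].
move=> ay ay1 ay2; have [_ d_tan Gy EQy] := ay; split=> // [i j|k k0].
  apply: (boundary_jacobian (fun i l => dcomp F i l y) (fun i j k => G i j k y)
    (fun k => U k y) d_tan nu mu nu0 mu0 Gy) => [p q r q0 r0|k k0].
    by rewrite -EQy ay1.
  by rewrite -EQy ay2.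
apply: (tangential_Upsilon0 (fun i l => dcomp F i l y) (fun i j k => G i j k y)
    (fun k => U k y) d_tan nu mu nu0 mu0 Gy) => [p q r q0 r0|l l0|//].
  by rewrite -EQy ay1.
by rewrite -EQy ay2.
Qed.

Theorem boundary_jet : (forall i j, dcomp F i j x0 = (i == j)%:R) /\ forall k, U k x0 = 0.
Proof.
have [[_ d_tan Gx EQx] J Ut] := nbhs_singleton near_jacobian bx0.
split=> // k; have [->|] := eqVneq k ord0; last exact: Ut.
have [_ ax1 ax2] := nbhs_singleton near_alg2 bx0.
apply: (normal_Upsilon0 (fun i l => dcomp F i l x0) (fun i j k => G i j k x0)
    (fun k => U k x0) d_tan nu mu nu0 mu0 Gx) => [p q r q0 r0|l l0|].
- by rewrite -EQx ax1.
- by rewrite -EQx ax2.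
(* The hypothesis [rhs2] is a tangential derivative of [dcomp F nu ord0], which [near_jacobian]
   shows to be constant along the boundary. *)
rewrite -EQx /dcomp (derive_boundary _ (fun=> (nu == ord0)%:R))//; first exact: derive_cst.
by apply: (@filterS _ (nbhs x0) _ _ _ _ near_jacobian) => y Hy /Hy[_ + _]; exact.
Qed.

End BoundaryJet.

(** * Smooth functions and vector fields on the manifold *)

Section Charts.
Context {R : realType} {n : nat} {M : bmanifold R n}.
Local Notation E := 'rV[R]_n.+1.
(* [coord] alone now denotes the coordinates of vector.v *)
Local Notation coord := Defs.coord.
Implicit Types (c : chart R n M) (U V : set M) (f g : M -> R) (X Y Z : operator M).

Lemma coordK c q : atlas c -> cdom c q -> param c (coord c q) = q.
Proof. by move=> /atlas_chart[_ _ + _ _]; exact. Qed.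

Lemma open_cdom c : atlas c -> open (cdom c).
Proof. by move=> /atlas_chart[]. Qed.

Lemma coord_halfspace c q : atlas c -> cdom c q -> halfspace (coord c q).
Proof.
move=> /atlas_chart[_ [W oW cW] _ _ _] cq.
suff [] : (W `&` halfspace) (coord c q) by [].
by rewrite -cW; exists q.
Qed.

Lemma coord_image c U q : U q -> (coord c @` U) (coord c q).
Proof. by move=> Uq; exists q. Qed.

Lemma param_image c U x : atlas c -> U `<=` cdom c -> (coord c @` U) x ->
  U (param c x) /\ coord c (param c x) = x.
Proof. by move=> ac Uc [q Uq <-]; rewrite coordK//; exact: Uc. Qed.

(** The image consists of the points of [cimage c] that [param c] sends into [U]. Continuity of
    [param c] there, and the open set that cuts [cimage c] out of the half-space, make it relatively
    open. *)
Lemma relopen_image c U : atlas c -> open U -> U `<=` cdom c -> relopen (coord c @` U).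
Proof.
move=> ac oU Uc; split=> [x [q Uq <-]|x [q Uq <-]].
  by apply: coord_halfspace => //; exact: Uc.
have [_ [W oW cW] _ _ cp] := atlas_chart ac.
have cq : cimage c (coord c q) by apply: coord_image; exact: Uc.
have Wq : W (coord c q) by move: cq; rewrite cW => -[].
have pU : nbhs (param c (coord c q)) U.
  by rewrite coordK//; [exact: open_nbhs_nbhs|exact: Uc].
have nU : \forall y \near coord c q, cimage c y -> U (param c y).
  by move/subspace_continuousP : cp => /(_ _ cq); exact.
have nW : \forall y \near coord c q, W y by exact: open_nbhs_nbhs.
apply: (@filterS2 _ (nbhs (coord c q)) _ _ _ _ _ nW nU) => y Wy Uy Hy.
have cy : cimage c y by rewrite cW.
have [_ <-] := param_image c (cdom c) y ac (fun _ H => H) cy.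
exact/coord_image/Uy.
Qed.

Lemma coord_cvg c q : atlas c -> cdom c q -> coord c @ q --> coord c q.
Proof.
move=> ac cq; have [oc _ _ + _] := atlas_chart ac.
by rewrite continuous_open_subspace// => /(_ q); apply; rewrite inE.
Qed.

Lemma smooth_fun_sub U V f : U `<=` V -> smooth_fun V f -> smooth_fun U f.
Proof.
move=> UV sf c ac; apply: smooth_on_sub (sf c ac).
by apply: image_subset => q [Uq cq]; split=> //; exact: UV.
Qed.

Lemma smooth_fun_ext U f g : (forall q, U q -> f q = g q) -> smooth_fun U f -> smooth_fun U g.
Proof.
move=> fg sf c ac; apply: smooth_on_ext (sf c ac) => x [q [Uq cq] <-] /=.
by rewrite coordK// fg.
Qed.

Lemma smooth_fun_cst U (a : R) : smooth_fun U (fun=> a).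
Proof. by move=> c ac; exact: smooth_on_cst. Qed.

Lemma smooth_funD U f g : smooth_fun U f -> smooth_fun U g -> smooth_fun U (fun q => f q + g q).
Proof. by move=> sf sg c ac; exact: smooth_onD (sf c ac) (sg c ac). Qed.

Lemma smooth_funM U f g : smooth_fun U f -> smooth_fun U g -> smooth_fun U (fun q => f q * g q).
Proof. by move=> sf sg c ac; exact: smooth_onM (sf c ac) (sg c ac). Qed.

(** In any other chart [f] is its expression in [c] composed with a smooth transition. *)
Lemma smooth_fun_chart c U f : atlas c -> U `<=` cdom c ->
  smooth_on (coord c @` U) (f \o param c) -> smooth_fun U f.
Proof.
move=> ac Uc sf c' ac'; have [sc' _] := atlas_compatible ac' ac.
apply: (@smooth_on_ext _ _ _ ((f \o param c) \o (fun x => coord c (param c' x)))).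
  by move=> x [q [Uq c'q] <-] /=; rewrite !coordK//; exact: Uc.
apply: smooth_on_comp sf => [l|x [q [Uq c'q] <-]].
  apply: smooth_on_sub (sc' l); apply: image_subset => q [Uq c'q].
  by split=> //; exact: Uc.
by rewrite coordK//; exact: coord_image.
Qed.

Lemma smooth_on_chart c U f : atlas c -> U `<=` cdom c -> smooth_fun U f ->
  smooth_on (coord c @` U) (f \o param c).
Proof. by move=> ac Uc /(_ c ac); rewrite setIidl. Qed.

Lemma smooth_fun_coord c i : atlas c -> smooth_fun (cdom c) (fun q => coord c q 0 i).
Proof.
move=> ac; apply: (smooth_fun_chart c) => //.
apply: smooth_on_ext (smooth_on_coord _ i) => x cx /=.
by have [_ ->] := param_image c (cdom c) x ac (fun _ H => H) cx.
Qed.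

Lemma smooth_fun_partial c i U f : atlas c -> open U -> U `<=` cdom c ->
  smooth_fun U f -> smooth_fun U (coord_field c i f).
Proof.
move=> ac oU Uc sf; apply: (smooth_fun_chart c) => //.
have rS := relopen_image c U ac oU Uc.
apply: (@smooth_on_ext _ _ _ (hpartial i (f \o param c))).
  by move=> x Ux; rewrite /coord_field /=; have [_ ->] := param_image c U x ac Uc Ux.
exact/smooth_on_hpartial/smooth_on_chart.
Qed.

Lemma smooth_fun_comp c U V (Phi : M -> M) f : atlas c -> V `<=` cdom c ->
  (forall q, U q -> V (Phi q)) ->
  (forall l, smooth_fun U (fun q => coord c (Phi q) 0 l)) ->
  smooth_fun V f -> smooth_fun U (f \o Phi).
Proof.
move=> ac Vc PhiUV sPhi sf c' ac'.
apply: (@smooth_on_ext _ _ _ ((f \o param c) \o (fun x => coord c (Phi (param c' x))))).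
  by move=> x [q [Uq c'q] <-] /=; rewrite !coordK//; exact/Vc/PhiUV.
apply: smooth_on_comp (smooth_on_chart c V f ac Vc sf) => [l|x [q [Uq c'q] <-]].
  exact: sPhi.
by rewrite coordK//; exact/coord_image/PhiUV.
Qed.

Lemma chain_rule c c' U V (Phi : M -> M) f i q : atlas c -> atlas c' ->
  open U -> U `<=` cdom c -> open V -> V `<=` cdom c' ->
  (forall q, U q -> V (Phi q)) ->
  (forall l, smooth_fun U (fun q => coord c' (Phi q) 0 l)) ->
  smooth_fun V f -> U q ->
  coord_field c i (f \o Phi) q =
  \sum_l coord_field c' l f (Phi q) * coord_field c i (fun q => coord c' (Phi q) 0 l) q.
Proof.
move=> ac ac' oU Uc oV Vc PhiUV sPhi sf Uq; rewrite /coord_field.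
have rS := relopen_image c U ac oU Uc; have rS' := relopen_image c' V ac' oV Vc.
pose F x := coord c' (Phi (param c x)).
have sF l : smooth_on (coord c @` U) (fun x => F x 0 l).
  exact: (smooth_on_chart c U (fun q => coord c' (Phi q) 0 l)).
have FS x : (coord c @` U) x -> (coord c' @` V) (F x).
  by move=> [p Up <-]; rewrite /F coordK; [exact/coord_image/PhiUV| |exact: Uc].
have sf' := smooth_on_chart c' V f ac' Vc sf.
have Sq : (coord c @` U) (coord c q) by exact: coord_image.
rewrite (hpartial_eq (coord c @` U) _ ((f \o param c') \o F))//; last first.
- exact: smooth_on_comp sf'.
- move=> x Ux; have [Upx _] := param_image c U x ac Uc Ux.
  by rewrite /F /= coordK//; exact/Vc/PhiUV.
rewrite (hpartial_comp (coord c @` U) (coord c' @` V))//.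
by apply: eq_bigr => l _; rewrite /F coordK//; exact: Uc.
Qed.

Lemma coord_field_coord c i l q : atlas c -> cdom c q ->
  coord_field c i (fun q => coord c q 0 l) q = (i == l)%:R.
Proof.
move=> ac cq; rewrite /coord_field.
have rS := relopen_image c (cdom c) ac (open_cdom c ac) (fun _ H => H).
have Sq : (coord c @` cdom c) (coord c q) by exact: coord_image.
rewrite -(hpartial_coord _ i l (coord c q) rS Sq).
apply: (hpartial_eq (coord c @` cdom c)) => //; last exact: smooth_on_coord.
by move=> x cx /=; have [_ ->] := param_image c (cdom c) x ac (fun _ H => H) cx.
Qed.

Lemma vf_eq_refl U X : vf_eq U X X.
Proof. by []. Qed.

Lemma vf_eq_sym U X Y : vf_eq U X Y -> vf_eq U Y X.
Proof. by move=> XY V f oV VU sf q Vq; rewrite (XY V). Qed.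

Lemma vf_eq_trans U X Y Z : vf_eq U X Y -> vf_eq U Y Z -> vf_eq U X Z.
Proof. by move=> XY YZ V f oV VU sf q Vq; rewrite (XY V)// (YZ V). Qed.

Lemma vf_eq_sub U V X Y : V `<=` U -> vf_eq U X Y -> vf_eq V X Y.
Proof.
by move=> VU XY W f oW WV; apply: XY => //; exact: subset_trans WV VU.
Qed.

Lemma vf_eq_add U X X' Y Y' : vf_eq U X X' -> vf_eq U Y Y' -> vf_eq U (vf_add X Y) (vf_add X' Y').
Proof. by move=> XX YY V f oV VU sf q Vq; rewrite /vf_add (XX V)// (YY V). Qed.

Lemma vector_field_eq U X Y : vector_field U X -> vf_eq U X Y -> vector_field U Y.
Proof.
move=> vX XY c ac; have [a [sa Xa]] := vX c ac; exists a; split=> //.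
apply: vf_eq_trans Xa; apply: vf_eq_sym; apply: vf_eq_sub XY.
exact: subIsetl.
Qed.

Lemma vector_field_coord c i U : atlas c -> open U -> U `<=` cdom c ->
  vector_field U (coord_field c i).
Proof.
move=> ac oU Uc c' ac'; exists (fun l => coord_field c i (fun q => coord c' q 0 l)).
have oUc' : open (U `&` cdom c') by apply: openI => //; exact: open_cdom.
split=> [l|V f oV VU sf q Vq].
  apply: smooth_fun_partial => //; first by move=> q [/Uc].
  by apply: smooth_fun_sub (smooth_fun_coord c' l ac') => q [].
have Vc : V `<=` cdom c by move=> p /VU[/Uc].
have Vc' : V `<=` cdom c' by move=> p /VU[].
rewrite (chain_rule c c' V V id f)// => [|l].
  by apply: eq_bigr => l _; rewrite mulrC.
by apply: smooth_fun_sub (smooth_fun_coord c' l ac').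
Qed.

Lemma vector_field0 U : vector_field U (fun _ _ => 0).
Proof.
move=> c ac; exists (fun _ _ => 0); split=> [i|V f oV VU sf q Vq].
  exact: smooth_fun_cst.
by rewrite big1// => i _; rewrite mul0r.
Qed.

Lemma vector_field_add U X Y : vector_field U X -> vector_field U Y ->
  vector_field U (vf_add X Y).
Proof.
move=> vX vY c ac; have [a [sa Xa]] := vX c ac; have [b [sb Yb]] := vY c ac.
exists (fun i q => a i q + b i q); split=> [i|V f oV VU sf q Vq].
  exact: smooth_funD.
rewrite /vf_add (Xa V)// (Yb V)// -big_split /=.
by apply: eq_bigr => i _; rewrite mulrDl.
Qed.

Lemma vector_field_scale U a X : smooth_fun U a -> vector_field U X ->
  vector_field U (vf_scale a X).
Proof.
move=> sa vX c ac; have [b [sb Xb]] := vX c ac.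
exists (fun i q => a q * b i q); split=> [i|V f oV VU sf q Vq].
  by apply: smooth_funM => //; apply: smooth_fun_sub sa; exact: subIsetl.
rewrite /vf_scale (Xb V)// mulr_sumr.
by apply: eq_bigr => i _; rewrite mulrA.
Qed.

(** Indexed by a list, so that the binary axioms of a connection extend to it by induction. *)
Definition vf_comb (J : Type) (r : seq J) (a : J -> M -> R) (Z : J -> operator M) : operator M :=
  fun f q => \sum_(j <- r) a j q * Z j f q.

Lemma vf_comb_nil (J : Type) (a : J -> M -> R) (Z : J -> operator M) :
  vf_comb J [::] a Z = fun _ _ => 0.
Proof. by apply/funext => f; apply/funext => q; rewrite /vf_comb big_nil. Qed.

Lemma vf_comb_cons (J : Type) (j : J) r (a : J -> M -> R) (Z : J -> operator M) :
  vf_comb J (j :: r) a Z = vf_add (vf_scale (a j) (Z j)) (vf_comb J r a Z).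
Proof. by apply/funext => f; apply/funext => q; rewrite /vf_comb big_cons. Qed.

Lemma vector_field_comb (J : Type) (r : seq J) U (a : J -> M -> R) (Z : J -> operator M) :
  (forall j, smooth_fun U (a j)) -> (forall j, vector_field U (Z j)) ->
  vector_field U (vf_comb J r a Z).
Proof.
move=> sa vZ; elim: r => [|j r IH]; first by rewrite vf_comb_nil; exact: vector_field0.
by rewrite vf_comb_cons; apply: vector_field_add => //; exact: vector_field_scale.
Qed.

(** Evaluating the local expansion of [X] on the coordinate functions identifies its
    coefficients. *)
Lemma vector_field_in_chart c U X : atlas c -> open U -> U `<=` cdom c -> vector_field U X ->
  (forall i, smooth_fun U (X (fun q => coord c q 0 i))) /\
  vf_eq U X (fun f q => \sum_i X (fun q => coord c q 0 i) q * coord_field c i f q).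
Proof.
move=> ac oU Uc vX; have [a []] := vX c ac; rewrite setIidl// => sa Xa.
have aE i q : U q -> a i q = X (fun q => coord c q 0 i) q.
  move=> Uq; rewrite (Xa U)//; last by apply: smooth_fun_sub Uc (smooth_fun_coord c i ac).
  rewrite -[LHS](sum_kronr _ _ i (a^~ q)); apply: eq_bigr => l _.
  by rewrite mulrC coord_field_coord//; exact: Uc.
split=> [i|V f oV VU sf q Vq]; first by apply: smooth_fun_ext (sa i) => q; exact: aE.
by rewrite (Xa V)//; apply: eq_bigr => i _; rewrite aE//; exact: VU.
Qed.

End Charts.

(** * The transformation law of Christoffel symbols *)

Section Connections.
Context {R : realType} {n : nat} {M : bmanifold R n}.
Local Notation coord := Defs.coord.
Variables (nabla : operator M -> operator M -> operator M).
Hypothesis hN : affine_connection nabla.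
Variables (U : set M) (oU : open U).

Lemma nabla_combl (J : Type) (r : seq J) (a : J -> M -> R) (Z : J -> operator M) (Y : operator M) :
  (forall j, smooth_fun U (a j)) -> (forall j, vector_field U (Z j)) -> vector_field U Y ->
  vf_eq U (nabla (vf_comb J r a Z) Y) (vf_comb J r a (fun j => nabla (Z j) Y)).
Proof.
move=> sa vZ vY; have [_ _ lin _ _] := hN U oU.
elim: r => [|j r IH].
  rewrite !vf_comb_nil => V f oV VU sf q Vq.
  (* Additivity applied to zero fields reads t = t + t, which forces t = 0. *)
  have := lin (fun=> 1) _ _ Y (smooth_fun_cst U 1) (vector_field0 U) (vector_field0 U) vY
    V f oV VU sf q Vq.
  have -> : vf_add (vf_scale (fun=> 1) (fun _ _ => 0)) (fun _ _ => 0) =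
      (fun _ _ => 0) :> operator M.
    by apply/funext => g; apply/funext => p; rewrite /vf_add /vf_scale mul1r addr0.
  rewrite /vf_add /vf_scale mul1r => /eqP; rewrite -subr_eq0 opprD addrA subrr sub0r oppr_eq0.
  by move/eqP.
rewrite !vf_comb_cons; apply: vf_eq_trans.
  by apply: (lin (a j) (Z j)) => //; exact: vector_field_comb.
by apply: vf_eq_add => //; exact: vf_eq_refl.
Qed.

Lemma nabla_combr (J : Type) (r : seq J) (a : J -> M -> R) (Z : J -> operator M) (X : operator M) :
  (forall j, smooth_fun U (a j)) -> (forall j, vector_field U (Z j)) -> vector_field U X ->
  vf_eq U (nabla X (vf_comb J r a Z))
    (fun f q => \sum_(j <- r) (X (a j) q * Z j f q + a j q * nabla X (Z j) f q)).
Proof.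
move=> sa vZ vX; have [_ _ _ addr leib] := hN U oU.
elim: r => [|j r IH].
  rewrite !vf_comb_nil => V f oV VU sf q Vq; rewrite big_nil.
  have := addr X _ _ vX (vector_field0 U) (vector_field0 U) V f oV VU sf q Vq.
  have -> : vf_add (fun _ _ => 0) (fun _ _ => 0) = (fun _ _ => 0) :> operator M.
    by apply/funext => g; apply/funext => p; rewrite /vf_add addr0.
  rewrite /vf_add => /eqP; rewrite -subr_eq0 opprD addrA subrr sub0r oppr_eq0.
  by move/eqP.
rewrite vf_comb_cons => V f oV VU sf q Vq; rewrite big_cons.
have vaZ : vector_field U (vf_scale (a j) (Z j)) by exact: vector_field_scale.
have vc : vector_field U (vf_comb J r a Z) by exact: vector_field_comb.
rewrite (addr X _ _ vX vaZ vc V)// /vf_add (leib _ _ _ (sa j) vX (vZ j) V)// (IH V)//.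
Qed.

End Connections.

(** * Projective equivalence with the pullback, in coordinates *)

Section TransformationLaw.
Context {R : realType} {n : nat} {M : bmanifold R n}.
Local Notation coord := Defs.coord.
Variables (nabla : operator M -> operator M -> operator M).
Variables (Ups : operator M -> M -> R) (phi psi : M -> M) (c : chart R n M).
Hypotheses (hN : affine_connection nabla).
Hypotheses (phiK : cancel phi psi) (psiK : cancel psi phi).
Hypotheses (sphi : smooth_map phi) (spsi : smooth_map psi).
Hypothesis EQ : forall U X Y, open U -> vector_field U X -> vector_field U Y ->
  vf_eq U (pullback_connection phi psi nabla X Y)
    (vf_add (nabla X Y) (vf_add (vf_scale (Ups X) Y) (vf_scale (Ups Y) X))).
Hypothesis ac : atlas c.

Definition phi_coord l : M -> R := fun q => coord c (phi q) 0 l.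

Definition phi_dom : set M := cdom c `&` phi @^-1` cdom c.

(** The image of [phi_dom] under [phi], where the pushed-forward fields live. *)
Let V : set M := psi @^-1` phi_dom.

Lemma open_phi_dom : open phi_dom.
Proof.
apply: openI; first exact: open_cdom.
apply: open_comp; last exact: open_cdom.
by move=> q _; exact: sphi.1.
Qed.

Let oV : open V.
Proof.
apply: open_comp; last exact: open_phi_dom.
by move=> q _; exact: spsi.1.
Qed.

Let Uc : phi_dom `<=` cdom c. Proof. exact: subIsetl. Qed.

Let Vc : V `<=` cdom c. Proof. by move=> q [_]; rewrite /= psiK. Qed.

Let phiV q : phi_dom q -> V (phi q). Proof. by rewrite /V /= phiK. Qed.

Lemma smooth_phi_coord l : smooth_fun phi_dom (phi_coord l).
Proof. by apply: smooth_fun_sub (sphi.2 c ac l); exact: subIsetr. Qed.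

Local Notation d := (coord_field c).

(** The Jacobian of [phi] moved to the target by [psi]: the coefficients of the pushed-forward
    coordinate fields, as [pushE] shows. *)
Let A l j : M -> R := d j (phi_coord l) \o psi.

Let sdphi l j : smooth_fun phi_dom (d j (phi_coord l)).
Proof. by apply: smooth_fun_partial => //; [exact: open_phi_dom|exact: smooth_phi_coord]. Qed.

Let sA l j : smooth_fun V (A l j).
Proof.
apply: (smooth_fun_comp c V phi_dom psi) => // m.
by apply: smooth_fun_sub (spsi.2 c ac m) => q [].
Qed.

Let vd i (W : set M) : open W -> W `<=` cdom c -> vector_field W (d i).
Proof. by move=> oW Wc; exact: vector_field_coord. Qed.

Local Notation pushforward := Defs.pushforward.

Let push j := pushforward phi psi (d j).

Let pushE j : vf_eq V (push j) (vf_comb 'I_n.+1 (index_enum 'I_n.+1) (fun l => A l j) d).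
Proof.
move=> V0 f oV0 V0V sf q V0q; rewrite /push /pushforward /vf_comb.
pose U0 := phi @^-1` V0.
have oU0 : open U0 by apply: open_comp => // p _; exact: sphi.1.
have U0U : U0 `<=` phi_dom.
  by move=> p /V0V; rewrite /V /= phiK.
rewrite (chain_rule c c U0 V0 phi f)//.
- by apply: eq_bigr => l _; rewrite psiK mulrC.
- by move=> p /U0U /Uc.
- by move=> p /V0V /Vc.
- by move=> l; apply: smooth_fun_sub (smooth_phi_coord l).
- by rewrite /U0 /= psiK.
Qed.

Let vpush j : vector_field V (push j).
Proof.
apply: vector_field_eq (vf_eq_sym _ _ _ (pushE j)); apply: vector_field_comb => // l.
exact: vd.
Qed.

(** [EQ] for the fields [d j] and [d k] is evaluated on the function [phi_coord i]. On the pullback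
    side this function becomes the plain coordinate [i], and expanding the pushed-forward fields
    produces second derivatives by the Leibniz rule, plus the quadratic Christoffel term. *)
Lemma transformation_law q i j k : phi_dom q ->
  d j (d k (phi_coord i)) q =
    \sum_l d l (phi_coord i) q * christoffel nabla c l j k q
    + d j (phi_coord i) q * Ups (d k) q + d k (phi_coord i) q * Ups (d j) q
    - \sum_l \sum_m christoffel nabla c i l m (phi q) *
        (d j (phi_coord l) q * d k (phi_coord m) q).
Proof.
move=> Uq; have oU := open_phi_dom.
have Vq := phiV q Uq.
have vdU i' : vector_field phi_dom (d i') by exact: vd.
have vdV i' : vector_field V (d i') by exact: vd.
have [closU _ _ _ _] := hN phi_dom oU.
have [_ compV _ _ _] := hN V oV.
have scV m : smooth_fun V (fun q' => coord c q' 0 m).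
  exact: smooth_fun_sub Vc (smooth_fun_coord c m ac).
have := EQ phi_dom (d j) (d k) oU (vdU j) (vdU k) phi_dom (phi_coord i) oU
  (fun _ H => H) (smooth_phi_coord i) q Uq.
rewrite /vf_add /vf_scale.
have [_ NE] := vector_field_in_chart c phi_dom _ ac oU Uc (closU _ _ (vdU j) (vdU k)).
rewrite (NE phi_dom)//; last exact: smooth_phi_coord.
rewrite /pullback_connection {1}/pushforward.
have -> : phi_coord i \o psi = fun q' => coord c q' 0 i.
  by apply/funext => q'; rewrite /phi_coord /= psiK.
have vcomb k' : vector_field V (vf_comb 'I_n.+1 (index_enum 'I_n.+1) (fun l => A l k') d).
  by apply: vector_field_comb.
rewrite (compV _ _ _ _ (vpush j) (vcomb j) (vpush k) (vcomb k) (pushE j) (pushE k) V)//.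
rewrite (nabla_combl nabla hN V oV _ _ (fun l => A l j) d _ (fun l => sA l j) vdV (vcomb k) V)//.
rewrite /vf_comb.
under eq_bigr => l _ do
  rewrite (nabla_combr nabla hN V oV _ _ (fun l => A l k) d (d l) (fun l => sA l k) vdV
             (vdV l) V)// big_split mulrDr /=.
rewrite big_split /=.
(* The inner sum reduces to [m = i], and the outer one is the chain rule for [A i k \o phi]. *)
have -> : \sum_l A l j (phi q) * \sum_m d l (A m k) (phi q) * d m (fun q' => coord c q' 0 i) (phi q)
   = d j (d k (phi_coord i)) q.
  have -> : d k (phi_coord i) = A i k \o phi by apply/funext => p; rewrite /A /= phiK.
  rewrite (chain_rule c c phi_dom V phi (A i k))//; last exact: smooth_phi_coord.
  apply: eq_bigr => l _; rewrite mulrC /A /= phiK; congr (_ * _).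
  rewrite -[RHS](sum_kronr _ _ i (fun m => d l (A m k) (phi q))); apply: eq_bigr => m _.
  by rewrite mulrC coord_field_coord//; exact: Vc.
have -> : \sum_l A l j (phi q) *
    \sum_m A m k (phi q) * nabla (d l) (d m) (fun q' => coord c q' 0 i) (phi q)
  = \sum_l \sum_m christoffel nabla c i l m (phi q) *
        (d j (phi_coord l) q * d k (phi_coord m) q).
  apply: eq_bigr => l _; rewrite mulr_sumr; apply: eq_bigr => m _.
  by rewrite /A /= phiK /christoffel mulrA mulrC.
have -> : \sum_l nabla (d j) (d k) (fun q' => coord c q' 0 l) q * d l (phi_coord i) q
  = \sum_l d l (phi_coord i) q * christoffel nabla c l j k q.
  by apply: eq_bigr => l _; rewrite mulrC.
move=> eq; rewrite -[LHS](addrK (\sum_l \sum_m christoffel nabla c i l m (phi q) *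
        (d j (phi_coord l) q * d k (phi_coord m) q))) eq; congr (_ - _).
by rewrite -addrA; congr (_ + _); rewrite addrC; congr (_ + _); rewrite mulrC.
Qed.

End TransformationLaw.

(** * Fixed points of projective transformations *)

Section IdentityJet.
Context {R : realType} {n : nat}.
Local Notation E := 'rV[R]_n.+1.

(** Both derivatives equal the one-sided [hpartial], which sees only the half-space; this covers
    boundary points as well. *)
Lemma derive_eq_halfspace (f g : E -> R) x i : halfspace x ->
  derivable f x (evec i) -> derivable g x (evec i) ->
  (\forall y \near x, halfspace y -> f y = g y) ->
  'D_(evec i) f x = 'D_(evec i) g x.
Proof.
move=> Hx df dg fg; rewrite -(hpartial_ext i f g)//.
by apply: esym; apply: hpartial_ext => //; exact: (@nearW _ (nbhs x)).
Qed.

Variables (F : E -> E) (G : 'I_n.+1 -> 'I_n.+1 -> 'I_n.+1 -> E -> R).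
Variables (U : 'I_n.+1 -> E -> R) (W : set E) (z : E).
Hypotheses (oW : open W) (Wz : W z) (Hz : halfspace z).
Hypothesis sF : forall i, smooth_open W (fun y => F y 0 i).
Hypothesis Fid : \forall y \near z, halfspace y -> F y = y.
Hypothesis EQz : forall i j k, 'D_(evec j) (dcomp F i k) z = proj_rhs F G U i j k z.

Let near_dcomp : \forall y \near z, halfspace y -> forall i j, dcomp F i j y = (i == j)%:R.
Proof.
have nW : \forall y \near z, W y by exact: open_nbhs_nbhs.
apply: (@filterS2 _ (nbhs z) _ _ _ _ _ nW (near_join Fid)) => y Wy Fy Hy i j.
have [dc vc] := is_derive_coord i (evec j) y.
have -> : (i == j)%:R = 'D_(evec j) (fun y : E => y 0 i) y by rewrite vc mxE eqxx.
apply: derive_eq_halfspace => //; first exact: smooth_open_derivable (sF i) Wy.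
by apply: (@filterS _ (nbhs y) _ _ _ _ Fy) => t Ft Ht; rewrite Ft.
Qed.

(** Second derivatives vanish and the Christoffel terms cancel, so the equation with [i = j = k]
    reads [0 = 2 * U k]. *)
Lemma identity_jet : [/\ F z = z, forall i j, dcomp F i j z = (i == j)%:R & forall k, U k z = 0].
Proof.
have Fz : F z = z by exact: (nbhs_singleton Fid).
have DF i j : dcomp F i j z = (i == j)%:R by exact: (nbhs_singleton near_dcomp).
split=> // k; have := EQz k k k.
have -> : 'D_(evec k) (dcomp F k k) z = 0.
  rewrite -[RHS](derive_cst ((k == k)%:R : R) z (evec k)).
  apply: derive_eq_halfspace => //.
  - exact: smooth_open_derivable (smooth_open_derive _ _ k (sF k)) Wz.
  - by apply: (@filterS _ (nbhs z) _ _ _ _ near_dcomp) => y Dy Hy; rewrite Dy.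
rewrite /proj_rhs Fz.
under eq_bigr do rewrite DF.
under [X in _ - X]eq_bigr do under eq_bigr do rewrite !DF mulrA mulrC.
under [X in _ - X]eq_bigr do rewrite sum_kronr mulrC.
rewrite sum_kron sum_kronr !DF eqxx !mul1r.
by move: (G k k k z) (U k z) => a b; lra.
Qed.

End IdentityJet.

Section FixedPoints.
Context {R : realType} {n : nat} {M : bmanifold R n}.
Local Notation coord := Defs.coord.
Local Notation E := 'rV[R]_n.+1.
Variables (nabla : operator M -> operator M -> operator M).
Variables (Ups : operator M -> M -> R) (phi psi : M -> M).
Hypothesis n0 : (0 < n)%N.
Hypotheses (hN : affine_connection nabla) (hU : one_form Ups).
Hypotheses (phiK : cancel phi psi) (psiK : cancel psi phi).
Hypotheses (sphi : smooth_map phi) (spsi : smooth_map psi).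
Hypothesis EQ : forall U X Y, open U -> vector_field U X -> vector_field U Y ->
  vf_eq U (pullback_connection phi psi nabla X Y)
    (vf_add (nabla X Y) (vf_add (vf_scale (Ups X) Y) (vf_scale (Ups Y) X))).

Section Local.
Variables (c : chart R n M) (q0 : M).
Hypotheses (ac : atlas c) (cq0 : cdom c q0) (fq0 : phi q0 = q0).
Let x0 := coord c q0.

(** Produces the data for [local_rigidity] and [boundary_jet]. Beyond the boundary the extensions
    are arbitrary, hence the restriction of the last clause to the half-space. *)
Lemma local_extension : exists F G U W V,
  [/\ [/\ open W, W x0, forall i, smooth_open W (fun y => (F y : E) 0 i) &
          forall k : 'I_n.+1, smooth_open W (U k)],
      [/\ open V, V x0, forall i j k : 'I_n.+1, smooth_open V (G i j k) &
          forall i j k, G i j k x0 = christoffel nabla c i j k q0],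
      F x0 = x0 &
      \forall x \near x0, halfspace x ->
        [/\ phi_dom phi c (param c x), coord c (param c x) = x,
            F x = coord c (phi (param c x)) &
            forall i j k, 'D_(evec j) (dcomp F i k) x = proj_rhs F G U i j k x]].
Proof.
have oD := open_phi_dom phi c sphi ac.
have Dc : phi_dom phi c `<=` cdom c by exact: subIsetl.
have Dq0 : phi_dom phi c q0 by split=> //=; rewrite fq0.
pose S := coord c @` phi_dom phi c; pose S0 := coord c @` cdom c.
have rS : relopen S by exact: relopen_image.
have cc : cdom c `<=` cdom c by [].
have oc := open_cdom c ac.
have Sx0 : S x0 by exact: coord_image.
have S0x0 : S0 x0 by exact: coord_image.
have vd i : vector_field (cdom c) (coord_field c i) by exact: vector_field_coord.
have [closN _ _ _ _] := hN (cdom c) oc.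
have sGam i j k : smooth_on S0 (christoffel nabla c i j k \o param c).
  apply: smooth_on_chart => //.
  by have [+ _] := vector_field_in_chart c (cdom c) _ ac oc cc (closN _ _ (vd j) (vd k)); exact.
have sUps k : smooth_on S (Ups (coord_field c k) \o param c).
  apply: smooth_on_chart => //; apply: smooth_fun_sub Dc _.
  by have [+ _ _] := hU (cdom c) oc; apply.
have sPhi i : smooth_on S (fun x => coord c (phi (param c x)) 0 i).
  by have := smooth_on_chart c _ _ ac Dc (smooth_phi_coord phi c sphi ac i).
have [W1 [F [oW1 W1x0 sF FE]]] := smooth_on_row S (fun x => coord c (phi (param c x))) x0 sPhi Sx0.
have [W2 [U [oW2 W2x0 sU UE]]] := smooth_on_family _ S _ x0 sUps Sx0.
(* The Christoffel symbols are extended from the whole chart image [S0]: they are also evaluated at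
   [F x], which need not lie in [S]. *)
have [V [G [oV Vx0 sG GE]]] := smooth_on_family ('I_n.+1 * 'I_n.+1 * 'I_n.+1)%type S0
  (fun p => christoffel nabla c p.1.1 p.1.2 p.2 \o param c) x0 (fun p => sGam _ _ _) S0x0.
exists F, (fun i j k => G (i, j, k)), U, (W1 `&` W2), V.
have Fx0 : F x0 = x0 by rewrite -FE//= /x0 coordK// fq0.
split=> //.
- split=> [|//|i|k]; first exact: openI.
    by apply: smooth_open_sub (sF i); exact: subIsetl.
  by apply: smooth_open_sub (sU k); exact: subIsetr.
- by split=> // i j k; rewrite -(GE (i, j, k))//= /x0 coordK.
have cF : continuous_at x0 F.
  by apply: continuous_row => l; exact: smooth_open_continuous (sF l) W1x0.
have nV : \forall x \near x0, V (F x).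
  by apply: cF; rewrite Fx0; exact: open_nbhs_nbhs.
have nVx : \forall x \near x0, V x by exact: open_nbhs_nbhs.
have nW1 : \forall x \near x0, W1 x by exact: open_nbhs_nbhs.
have nW2 : \forall x \near x0, W2 x by exact: open_nbhs_nbhs.
have dE i k y : W1 y -> S y ->
    (coord_field c k (phi_coord phi c i) \o param c) y = dcomp F i k y.
  move=> W1y Sy; have [_ py] := param_image c _ y ac Dc Sy.
  rewrite /= /coord_field py; apply: (hpartial_smooth S W1) => //.
  by move=> t W1t St; rewrite /= /phi_coord FE.
have nVV := @filterI _ (nbhs x0) (nbhs_filter x0) _ _ nV nVx.
have nWW := @filterI _ (nbhs x0) (nbhs_filter x0) _ _ nW1 nW2.
have nS := @filterI _ (nbhs x0) (nbhs_filter x0) _ _ nWW (rS.2 x0 Sx0).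
apply: (@filterS2 _ (nbhs x0) _ _ _ _ _ nVV nS) => x [VFx Vx] [[W1x W2x] HS] Hx.
have Sx := HS Hx.
have [Dx px] := param_image c _ x ac Dc Sx.
split=> // [|i j k]; first by rewrite FE.
have S0x : S0 x by exists (param c x) => //; exact: Dc.
have S0F : S0 (F x) by rewrite -FE//; apply: coord_image; exact: Dx.2.
have Fpx : param c (F x) = phi (param c x) by rewrite -FE// coordK//; exact: Dx.2.
rewrite -(hpartial_smooth S W1 (coord_field c k (phi_coord phi c i) \o param c) _ x j)//;
  last 2 first.
- exact: smooth_open_derive (sF i).
- by move=> y; exact: dE.
rewrite -[in LHS]px.
have := transformation_law nabla Ups phi psi c hN phiK psiK sphi spsi EQ ac (param c x) i j k Dx.
rewrite {1}/coord_field => ->.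
rewrite /proj_rhs -!dE// -!UE//=; congr (_ + _ + _ - _).
  by apply: eq_bigr => l _; rewrite -dE// -(GE (l, j, k)).
apply: eq_bigr => l _; apply: eq_bigr => m _.
by rewrite -!dE// -(GE (i, l, m))//= Fpx.
Qed.

Lemma near_fixed F (r : R) : 0 < r ->
  (\forall x \near x0, halfspace x ->
     [/\ phi_dom phi c (param c x), coord c (param c x) = x &
         F x = coord c (phi (param c x))]) ->
  (forall x, halfspace x -> ball x0 r x -> F x = x) ->
  \forall q \near q0, phi q = q.
Proof.
move=> r0 nF Fid.
have cc := coord_cvg c q0 ac cq0.
have n1 : \forall q \near q0, cdom c q by apply: open_nbhs_nbhs; split=> //; exact: open_cdom.
have n2 := cc _ nF.
have n3 := cc _ (nbhsx_ballx x0 r r0).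
apply: (@filterS3 _ (nbhs q0) _ _ _ _ _ _ n1 n2 n3) => q cq H br.
have Hq := coord_halfspace c q ac cq.
have [] := H Hq; rewrite coordK// => -[_ cpq] _.
rewrite Fid// => e; rewrite -[LHS](coordK c)// -[RHS](coordK c)//.
by rewrite -e.
Qed.

End Local.

Let fixed : set M := [set q | phi q = q].

Let closed_fixed q : closure fixed q -> phi q = q.
Proof.
move=> cl; apply: (@bm_hausdorff _ _ M) => A B nA nB.
have nA' : nbhs q (phi @^-1` A) by exact: sphi.1.
have [p [fp [Ap Bp]]] := cl _ (@filterI _ (nbhs q) _ _ _ nA' nB).
by exists p; split=> //; rewrite -fp.
Qed.

(** A limit point [q0] is fixed since the manifold is Hausdorff. Rigidity is set up around [q0], but
    the zero of the jet is taken at a nearby interior point, where [identity_jet] applies. *)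
Lemma interior_fixed_closed : closed (interior fixed).
Proof.
move=> q0 cl; have fq0 : phi q0 = q0.
  by apply: closed_fixed; apply: closure_subset cl; exact: interior_subset.
have [c ac cq0] := atlas_cover q0.
have [F [G [U [W [V [[oW Wx0 sF sU] [oV Vx0 sG GE] Fx0 nF]]]]]] := local_extension c q0 ac cq0 fq0.
have Hx0 := coord_halfspace c q0 ac cq0.
have EQ' : \forall x \near coord c q0, halfspace x ->
    forall i j k, 'D_(evec j) (dcomp F i k) x = proj_rhs F G U i j k x.
  by apply: (@filterS _ (nbhs (coord c q0)) _ _ _ _ nF) => x Fx /Fx[].
have [r r0 rig] := local_rigidity (coord c q0) F G U W V n0 Hx0 Fx0 oW Wx0 oV Vx0 sF sG sU EQ'.
apply: (near_fixed c q0 ac cq0 F r r0).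
  by apply: (@filterS _ (nbhs (coord c q0)) _ _ _ _ nF) => x Fx /Fx[].
have cc := coord_cvg c q0 ac cq0.
have nW : nbhs (coord c q0) W by exact: open_nbhs_nbhs.
have nbig : \forall q \near q0, [/\ cdom c q, W (coord c q), ball (coord c q0) r (coord c q) &
    \forall x \near coord c q, halfspace x ->
        [/\ phi_dom phi c (param c x), coord c (param c x) = x,
            F x = coord c (phi (param c x)) &
            forall i j k, 'D_(evec j) (dcomp F i k) x = proj_rhs F G U i j k x]].
  have m1 : \forall q \near q0, cdom c q by apply: open_nbhs_nbhs; split=> //; exact: open_cdom.
  have m2 := cc _ nW; have m3 := cc _ (nbhsx_ballx (coord c q0) r r0).
  have m4 := cc _ (near_join nF).
  have m12 := @filterI _ (nbhs q0) (nbhs_filter q0) _ _ m1 m2.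
  have m34 := @filterI _ (nbhs q0) (nbhs_filter q0) _ _ m3 m4.
  by apply: (@filterS2 _ (nbhs q0) _ _ _ _ _ m12 m34) => q [cq Wq] [].
(* [q1] is chosen after [r], so it lies in the ball on which vanishing propagates, and that ball is
   centred at [q0]. *)
have [q1 [iq1 [cq1 Wq1 bq1 nq1]]] := cl _ nbig.
pose z := coord c q1.
have Hz : halfspace z by exact: coord_halfspace.
pose N := interior fixed `&` cdom c.
have rN : relopen (coord c @` N).
  apply: relopen_image => //; last exact: subIsetr.
  by apply: openI; [exact: open_interior|exact: open_cdom].
have Nz : (coord c @` N) z by exact: coord_image.
have Fid : \forall y \near z, halfspace y -> F y = y.
  apply: (@filterS2 _ (nbhs z) _ _ _ _ _ (rN.2 z Nz) nq1) => y HN nF' Hy.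
  have [_ py Fy _] := nF' Hy; rewrite Fy -[RHS]py; congr (coord c _).
  by have [[/interior_subset]] := param_image c N y ac (@subIsetr _ _ _) (HN Hy).
have EQz i j k : 'D_(evec j) (dcomp F i k) z = proj_rhs F G U i j k z.
  by have [_ _ _ +] := nbhs_singleton nq1 Hz; exact.
have [Fz DFz Uz] := identity_jet F G U W z oW Wq1 Hz sF Fid EQz.
by move=> x Hx bx; apply: (rig z x).
Qed.

Lemma fixed_near_boundary c p nu mu : atlas c -> cdom c p -> coord c p 0 ord0 = 0 ->
  (forall q, bdry M q -> phi q = q) -> nu != ord0 -> mu != ord0 ->
  christoffel nabla c ord0 nu mu p != 0 -> interior fixed p.
Proof.
move=> ac cp bp fb nu0 mu0 Gp.
have fp : phi p = p by apply: fb; exists c.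
have [F [G [U [W [V [[oW Wx0 sF sU] [oV Vx0 sG GE] Fx0 nF]]]]]] := local_extension c p ac cp fp.
have Hx0 := coord_halfspace c p ac cp.
have EQ' : \forall x \near coord c p, halfspace x ->
    forall i j k, 'D_(evec j) (dcomp F i k) x = proj_rhs F G U i j k x.
  by apply: (@filterS _ (nbhs (coord c p)) _ _ _ _ nF) => x Fx /Fx[].
have [r r0 rig] := local_rigidity (coord c p) F G U W V n0 Hx0 Fx0 oW Wx0 oV Vx0 sF sG sU EQ'.
apply: (near_fixed c p ac cp F r r0).
  by apply: (@filterS _ (nbhs (coord c p)) _ _ _ _ nF) => x Fx /Fx[].
(* [boundary_jet] differentiates along the boundary, so nonvanishing is needed around [p];
   continuity provides it. *)
have nG : \forall x \near coord c p, G ord0 nu mu x != 0.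
  have cG := smooth_open_continuous V _ _ (sG ord0 nu mu) Vx0.
  apply: (cG [set y : R | y != 0]); apply: open_nbhs_nbhs; split.
    exact: open_neq.
  by rewrite /= GE.
have H : \forall x \near coord c p, (x : E) 0 ord0 = 0 ->
  [/\ F x = x, G ord0 nu mu x != 0 &
      forall i j k, 'D_(evec j) (dcomp F i k) x = proj_rhs F G U i j k x].
  apply: (@filterS2 _ (nbhs (coord c p)) _ _ _ _ _ nG nF) => x Gx nFx bx.
  have [|[cx _] px Fx EQx] := nFx; first by rewrite /halfspace /= bx.
  split=> //; rewrite Fx fb//.
  by exists c; rewrite px.
have [DF U0] := boundary_jet (coord c p) F G U W nu mu bp oW Wx0 sF nu0 mu0 H.
by move=> x Hx bx; apply: (rig (coord c p) x) => //; exact: ballxx.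
Qed.

End FixedPoints.

Section Rigidity.
Context {R : realType} {n : nat} {M : bmanifold R n}.
Local Notation coord := Defs.coord.

(** For upper index [ord0] and tangential lower indices, both trace corrections of [thomas] carry a
    zero Kronecker factor, leaving the Christoffel symbol. If all of these vanished, only the
    component along [dr] would remain. *)
Lemma exists_second_fundamental_form nabla (c : chart R n M) p nu : atlas c -> cdom c p ->
  nu != ord0 ->
  thomas_form nabla c ord0 nu p \notin <[differential c (rfun c) p]>%VS ->
  exists2 mu, mu != ord0 & christoffel nabla c ord0 nu mu p != 0.
Proof.
move=> ac cp nu0; apply: contraNP => Pi0.
(* In this chart [dr] is the first basis covector, so the multiple is the component of index
   [ord0]. *)
apply/vlineP; exists (thomas nabla c ord0 nu ord0 p); apply/rowP => mu.
rewrite !mxE /rfun coord_field_coord//.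
have [->|mu0] := eqVneq mu ord0; first by rewrite mulr1.
rewrite mulr0 /thomas 2!(eq_sym ord0) (negbTE nu0) (negbTE mu0) !mulr0 !subr0.
by apply/eqP; apply: contra_notT Pi0 => G0; exists mu.
Qed.

Lemma projective_transformation_id (P : set (operator M -> operator M -> operator M)) :
  projective_transformation P id.
Proof.
have sid : smooth_map (id : M -> M).
  by split=> [q|c ac i]; [exact: cvg_id|exact: smooth_fun_coord].
exists id; split=> // nabla _; exists (fun _ _ => 0).
  move=> U oU; split=> // [X vX|a X X' sa vX vX' q Uq]; first exact: smooth_fun_cst.
  by rewrite mulr0 addr0.
move=> U X Y oU vX vY V f oV VU sf q Vq.
by rewrite /vf_add /vf_scale !mul0r !addr0.
Qed.

End Rigidity.

Theorem theorem1p1 (R : realType) (n : nat) (hn : (2 <= n.+1)%N)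
  (M : bmanifold R n) (hM : connected [set: M])
  (P : set (operator M -> operator M -> operator M))
  (hP : projective_structure P)
  (nabla : operator M -> operator M -> operator M) (hnabla : P nabla)
  (hPi : exists p : M, bdry M p /\
    exists c : chart R n M, boundary_chart c /\ cdom c p /\
    exists2 nu : 'I_n.+1, (1 <= nu)%N &
      thomas_form nabla c ord0 nu p \notin <[differential c (rfun c) p]>%VS) :
  boundary_rigid P.
Proof.
have hN : affine_connection nabla.
  by move: hnabla; have [nabla0 [_ _ ->]] := hP => -[].
have [p [bp [c [[ac bc _] [cp [nu nu1 Pi]]]]]] := hPi.
have nu0 : nu != ord0 by rewrite -val_eqE /= -lt0n.
have [mu mu0 Gp] := exists_second_fundamental_form nabla c p nu ac cp nu0 Pi.
have r0 : Defs.coord c p 0 ord0 = 0.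
  have : (bdry M `&` cdom c) p by [].
  by rewrite bc => -[].
apply/seteqP; split=> [phi [[psi [phiK psiK sphi spsi pe]] fb]|_ ->]; last first.
  by split=> //; exact: projective_transformation_id.
have [Ups hU EQ] := pe nabla hnabla.
have ip := fixed_near_boundary nabla Ups phi psi hn hN hU phiK psiK sphi spsi EQ
  c p nu mu ac cp r0 fb nu0 mu0 Gp.
have cl := interior_fixed_closed nabla Ups phi psi hn hN hU phiK psiK sphi spsi EQ.
have fixT : interior [set q : M | phi q = q] = setT.
  apply: hM; first by exists p.
  - by exists (interior [set q : M | phi q = q]); [exact: open_interior|rewrite setTI].
  - by exists (interior [set q : M | phi q = q]); [exact: cl|rewrite setTI].
apply/funext => q; have : interior [set q : M | phi q = q] q by rewrite fixT.
exact: interior_subset.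
Qed.
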